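(* Let $G$ be a compact group and let $\alpha:G\to G$ be a continuous endomorphism. Let $G_0$ be the identity component of $G$ (so $\alpha(G_0)\subseteq G_0$). Then $\alpha$ has shadowing if and only if the restriction $\alpha|_{G_0}:G_0\to G_0$ has shadowing.
   Context: All topological groups are Hausdorff and all homomorphisms are continuous; no metrizability is assumed. Let $G$ be a topological group and $\alpha:G\to G$ a continuous endomorphism. For an identity neighbourhood $V$, a sequence $(x_i)_{i\in\mathbb N}$ in $G$ (with $0\in\mathbb N$) is a $V$-pseudo-orbit for $\alpha$ if $\alpha(x_i)^{-1}x_{i+1}\in V$ for all $i$. For an identity neighbourhood $U$, it is $U$-shadowed by $x\in G$ if $\alpha^i(x)^{-1}x_i\in U$ for all $i$. The endomorphism $\alpha$ has shadowing if for every identity neighbourhood $U$ there is an identity neighbourhood $V$ such that every $V$-pseudo-orbit indexed by $\mathbb N$ is $U$-shadowed by some point of $G$. *)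

(* Defs.v *)
From HB Require Import structures.
From mathcomp Require Import all_boot all_classical topology.

Set Implicit Arguments.
Unset Strict Implicit.
Unset Printing Implicit Defensive.

Local Open Scope classical_set_scope.
Local Open Scope group_scope.

(* Neither commutative nor Hausdorff by definition; separation is assumed
   explicitly where it is needed. *)
HB.mixin Record Topological_Group_isTopologicalGroup G
    & Topological G & monoid.Group G := {
  mulg_continuous : continuous (fun x : G * G => x.1 * x.2);
  invg_continuous : continuous (fun x : G => x^-1)
}.

#[short(type="topologicalGroupType")]
HB.structure Definition TopologicalGroup :=
  {G of Topological G & monoid.Group G
      & Topological_Group_isTopologicalGroup G}.

#[short(type="continuousHom")]
HB.structure Definition ContinuousHom (G H : topologicalGroupType) :=
  {f of @isContinuous G H f & @UMagmaMorphism G H f}.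

Section Shadowing.
Variable G : topologicalGroupType.
Implicit Types (alpha : G -> G) (U V : set G) (x : nat -> G).

Definition pseudo_orbit alpha V x : Prop :=
  forall i : nat, V ((alpha (x i))^-1 * x i.+1).

Definition shadowed_by alpha U x (y : G) : Prop :=
  forall i : nat, U ((iter i alpha y)^-1 * x i).

Definition has_shadowing alpha : Prop :=
  forall U, nbhs (1 : G) U ->
  exists2 V, nbhs (1 : G) V &
    forall x, pseudo_orbit alpha V x -> exists y : G, shadowed_by alpha U x y.

End Shadowing.

Section IdentityComponent.
Variable G : topologicalGroupType.

Definition identity_component : set G := connected_component [set: G] 1.

Lemma identity_component1 : identity_component 1.
Proof. exact: connected_component_refl. Qed.

Lemma identity_component_connected : connected identity_component.
Proof. exact: component_connected. Qed.

Lemma connected_sub_identity_component (A : set G) :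
  A 1 -> connected A -> A `<=` identity_component.
Proof. by move=> A1 cA; exact: connected_component_max. Qed.

Lemma mulg_fun_continuous (T : topologicalType) (f g : T -> G) :
  continuous f -> continuous g -> continuous (fun x => f x * g x).
Proof.
move=> cf cg x.
apply: (@continuous_comp _ _ _ (fun y => (f y, g y))
  (fun z : G * G => z.1 * z.2)); last exact: mulg_continuous.
by apply: cvg_pair; [exact: cf|exact: cg].
Qed.

Lemma identity_component_div (x y : G) :
  identity_component x -> identity_component y -> identity_component (x / y).
Proof.
move=> Cx Cy.
have cf : continuous (fun z : G => z / y).
  by apply: mulg_fun_continuous => z; [exact: cvg_id|exact: cvg_cst].
pose A : set G := (fun z : G => z / y) @` identity_component.
have A1 : A 1 by exists y => //; rewrite divgg.
have cA : connected A.
  apply: connected_continuous_connected; first exact: component_connected.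
  by apply: continuous_subspaceT.
by apply: (connected_sub_identity_component A1 cA); exists x.
Qed.

Lemma identity_component_group_closed :
  group_closed (fun x : G => x \in identity_component).
Proof.
split; first by apply/mem_set/identity_component1.
move=> x y /set_mem Cx /set_mem Cy; apply/mem_set.
exact: identity_component_div.
Qed.

(* An alias of set_type, so that the group structure inherited from G is not
   declared on arbitrary subsets; the topology is the one of set_type. *)
Definition identity_component_type : Type := set_type identity_component.

HB.instance Definition _ := Topological.on identity_component_type.
HB.instance Definition _ :=
  SubChoice.copy identity_component_type (set_type identity_component).
HB.instance Definition _ :=
  SubChoice_isSubGroup.Build G (fun x => x \in identity_component)
    identity_component_type identity_component_group_closed.

Let val0 : identity_component_type -> G := val.

Lemma identity_component_val_continuous : continuous val0.
Proof. exact: initial_continuous. Qed.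

Let mulg0_continuous : continuous
  (fun x : identity_component_type * identity_component_type => x.1 * x.2).
Proof.
apply: continuous_comp_initial.
have -> : set_val \o (fun x : identity_component_type * identity_component_type
    => x.1 * x.2) = (fun x => val0 x.1 * val0 x.2).
  by apply/funext => x; exact: (valM x.1 x.2).
apply: mulg_fun_continuous => x; apply: continuous_comp;
  by [exact: cvg_fst|exact: cvg_snd|exact: identity_component_val_continuous].
Qed.

Let invg0_continuous : continuous (fun x : identity_component_type => x^-1).
Proof.
apply: continuous_comp_initial.
have -> : set_val \o (fun x : identity_component_type => x^-1)
    = (fun x => (val0 x)^-1).
  by apply/funext.
move=> x; apply: continuous_comp; last exact: invg_continuous.
exact: identity_component_val_continuous.
Qed.

HB.instance Definition _ :=
  Topological_Group_isTopologicalGroup.Build identity_component_type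
    mulg0_continuous invg0_continuous.

End IdentityComponent.

Section Restriction.
Variables (G : topologicalGroupType) (alpha : continuousHom G G).

Lemma identity_component_stable (x : G) :
  identity_component x -> identity_component (alpha x).
Proof.
move=> Cx.
have cA : connected (alpha @` @identity_component G).
  apply: connected_continuous_connected; first exact: component_connected.
  by apply: continuous_subspaceT; exact: cts_fun.
apply: (connected_sub_identity_component _ cA); last by exists x.
by exists 1; [exact: identity_component1|exact: gmulf1].
Qed.

Definition identity_restriction (x : identity_component_type G) :
    identity_component_type G :=
  exist _ (alpha (val x))
    (mem_set (identity_component_stable (set_mem (valP x)))).

Lemma val_identity_restriction (x : identity_component_type G) :
  val (identity_restriction x) = alpha (val x).
Proof. by []. Qed.

Let identity_restriction_continuous : continuous identity_restriction.
Proof.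
apply: continuous_comp_initial => x.
apply: (@continuous_comp _ _ _ (val : identity_component_type G -> G) alpha).
  exact: identity_component_val_continuous.
exact: cts_fun.
Qed.

Let identity_restriction_morphism : monoid_morphism identity_restriction.
Proof.
split=> [|x y]; apply: val_inj; rewrite ?valM ?val1 !val_identity_restriction.
  by rewrite val1 gmulf1.
by rewrite valM gmulfM.
Qed.

HB.instance Definition _ :=
  isContinuous.Build _ _ identity_restriction identity_restriction_continuous.
HB.instance Definition _ :=
  isUMagmaMorphism.Build _ _ identity_restriction identity_restriction_morphism.

End Restriction.

(* Main.v *)
(* Every compact group G has arbitrarily small closed normal subgroups L such that
   the closed subgroups above L satisfy the descending chain condition
   ([noetherian L]). Indeed the spectral theorem for a convolution operator whose
   kernel is supported near 1 yields translation-invariant spaces of functions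
   with equicontinuous unit ball; the kernels of the translation action on them
   are noetherian and have a small intersection.

   Modulo a noetherian L, the orbits of the points of a closed alpha-invariant
   subgroup N form a shift of finite type: a sequence whose blocks of a fixed
   length are followed, modulo L, by points of N is followed by a single point of
   N. With G0 the identity component, G0 L is an open subgroup.

   If alpha has shadowing, a pseudo-orbit in G0 is shadowed by some y in G whose
   orbit stays in a prescribed open subgroup G0 M; finite type with N = G0
   replaces y by a point t of G0 with alpha^i t in (alpha^i y) L for all i.
   Conversely, finite type with N = G and the open subgroup G0 L gives, for a
   pseudo-orbit x in G, a point y with x_i = (alpha^i y) n_i u_i, where n_i is in
   G0 and u_i in L; then n is a pseudo-orbit in G0, and if t shadows n, then y t
   shadows x. *)
Require Import Defs.
From HB Require Import structures.
From mathcomp Require Import all_boot.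

Set Implicit Arguments.
Unset Strict Implicit.
Unset Printing Implicit Defensive.

(** * Marriage theorem *)

Section Hall.
Variables (S T : finType) (t0 : T).

(** Induction on the size of [X]. Either some proper nonempty subset is tight, with exactly as many
    neighbours as elements, and splits the problem in two; or every such subset has a neighbour to
    spare, and one pair can be matched arbitrarily. *)
Lemma hall_marriage (X : {set S}) (r : S -> {set T}) :
  (forall A : {set S}, A \subset X -> #|A| <= #|\bigcup_(i in A) r i|) ->
  exists f : S -> T, {in X &, injective f} /\ {in X, forall i, f i \in r i}.
Proof.
have [n] := ubnP #|X|; elim: n X r => // n IH X r ltXn hallX.
have [->|[i0 i0X]] := set_0Vmem X.
  by exists (fun=> t0); split=> i; rewrite inE.
pose N (r : S -> {set T}) (A : {set S}) := \bigcup_(i in A) r i.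
have [/existsP[A /and3P[A0 AX /eqP NA]]|] :=
    boolP [exists A : {set S}, [&& A != set0, A \proper X & #|N r A| == #|A|]].
(* [A] is tight: match it by itself, and [X :\: A] into the vertices outside [N r A]. Hall's
   condition for B in the latter is the one for the union of A and B, with the cardinal of A
   subtracted on both sides. *)
- have sAX := proper_sub AX.
  have [|B BA|f [fI fr]] := IH A r.
  + by apply: leq_trans (proper_card AX) _; rewrite -ltnS.
  + by apply: hallX; exact: subset_trans sAX.
  have [|B BXA|g [gI gr]] := IH (X :\: A) (fun i => r i :\: N r A).
  + rewrite cardsD (setIidPr sAX); apply: leq_trans (_ : #|X| <= n); last by rewrite -ltnS.
    rewrite ltn_subrL card_gt0 A0 card_gt0; apply/set0Pn; by exists i0.
  + have BA : A :&: B = set0.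
      apply/setP => i; rewrite !inE; apply/andP => -[iA iB].
      by have := subsetP BXA _ iB; rewrite inE iA.
    have : #|A :|: B| <= #|N r (A :|: B)|.
      by apply: hallX; rewrite subUset sAX (subset_trans BXA (subsetDl _ _)).
    rewrite cardsU BA cards0 subn0.
    have -> : N r (A :|: B) = N r A :|: \bigcup_(i in B) (r i :\: N r A).
      apply/setP => t; rewrite inE; apply/bigcupP/orP => [[i]|].
        rewrite inE => /orP[iA ti|iB ti]; first by left; apply/bigcupP; exists i.
        have [tA|tA] := boolP (t \in N r A); first by left.
        by right; apply/bigcupP; exists i => //; rewrite inE tA.
      case=> /bigcupP[i iA ti]; exists i => //; first by rewrite inE iA.
        by rewrite inE iA orbT.
      by move: ti; rewrite inE => /andP[].
    move=> /leq_trans/(_ (leq_card_setU _ _)).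
    by rewrite NA leq_add2l.
  have mixed i j : i \in A -> j \in X -> j \notin A -> f i <> g j.
    move=> iA jX jA fg; have := gr j; rewrite !inE jX jA => /(_ isT) /andP[/negP].
    by case; rewrite -fg; apply/bigcupP; exists i => //; exact: fr.
  exists (fun i => if i \in A then f i else g i); split=> [i j iX jX|i iX].
    case: ifPn => iA; case: ifPn => jA.
    + exact: fI.
    + by move=> /(mixed _ _ iA jX jA).
    + by move=> /esym/(mixed _ _ jA iX iA).
    + by apply: gI; rewrite inE ?iA ?jA.
  case: ifPn => iA; first exact: fr.
  by have := gr i; rewrite !inE iA iX => /(_ isT)/andP[].
(* No tight set: [i0] takes any neighbour [t]. Deleting [t] costs a subset at most one neighbour,
   which it can spare. *)
rewrite negb_exists => /forallP tight.
have : 0 < #|r i0|.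
  by have := hallX [set i0]; rewrite big_set1 cards1 sub1set; apply.
rewrite card_gt0 => /set0Pn[t tr].
have [|B BX|f [fI fr]] := IH (X :\ i0) (fun i => r i :\ t).
+ by rewrite -ltnS; apply: leq_trans ltXn; rewrite (cardsD1 i0 X) i0X.
+ have [->|B0] := eqVneq B set0; first by rewrite cards0.
  have i0B : i0 \notin B by apply/negP => /(subsetP BX); rewrite !inE eqxx.
  have sBX : B \subset X := subset_trans BX (subsetDl _ _).
  have := tight B; rewrite B0 /= properE sBX /= negb_and negbK.
  have -> : X \subset B = false by apply/negP => /subsetP/(_ _ i0X); apply/negP.
  move=> /= NB; have : #|B| < #|N r B| by rewrite ltn_neqAle eq_sym NB hallX.
  rewrite (cardsD1 t).
  have -> : N r B :\ t = \bigcup_(i in B) (r i :\ t).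
    apply/setP => u; rewrite !inE; apply/andP/bigcupP => [[ut /bigcupP[i iB ui]]|[i iB]].
      by exists i => //; rewrite !inE ut.
    by rewrite !inE => /andP[-> ui]; split=> //; apply/bigcupP; exists i.
  by case: (_ \in _) => /=; rewrite ?add0n ?add1n ?ltnS // => /ltnW.
have mixed i : i \in X -> i != i0 -> f i != t.
  by move=> iX ii0; have := fr i; rewrite !inE ii0 iX => /(_ isT)/andP[].
exists (fun i => if i == i0 then t else f i); split=> [i j iX jX|i iX].
  have [->|ii0] := eqVneq i i0; have [->|ji0] := eqVneq j i0 => //.
  + by move/esym/eqP; rewrite (negbTE (mixed _ jX ji0)).
  + by move/eqP; rewrite (negbTE (mixed _ iX ii0)).
  + by apply: fI; rewrite !inE ?ii0 ?ji0.
have [->//|ii0] := eqVneq i i0.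
by have := fr i; rewrite !inE ii0 iX => /(_ isT)/andP[].
Qed.

End Hall.

From mathcomp Require Import all_order all_algebra.
From mathcomp Require Import all_classical reals topology normedtype derive.
From mathcomp Require Import Rstruct ring lra.

Local Open Scope classical_set_scope.

(** * Compact spaces and topological groups *)

Section CompactSpaces.
Variable T : topologicalType.
Hypothesis compactT : compact [set: T].

(** Otherwise the sets A \ O generate a proper filter. A cluster point of it lies in every closed A,
    hence in O, which is then a neighbourhood disjoint from A \ O. With [O = set0] this is the
    finite intersection property. *)
Lemma compact_directed (D : set (set T)) (O : set T) :
  D !=set0 ->
  (forall A B, D A -> D B -> exists2 C, D C & C `<=` A `&` B) ->
  (forall A, D A -> closed A) -> open O -> \bigcap_(A in D) A `<=` O ->
  exists2 A, D A & A `<=` O.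
Proof.
move=> D0 dirD clD oO DO; apply: contrapT => noA.
have FF : ProperFilter (filter_from D (fun A => A `\` O)).
  apply: filter_from_proper.
    apply: filter_from_filter => // A B DA DB.
    have [C DC CAB] := dirD _ _ DA DB; exists C => // x [Cx nOx].
    by have [Ax Bx] := CAB _ Cx.
  move=> A DA; apply: contrapT => /set0P/negP; rewrite negbK => /eqP AO.
  by apply: noA; exists A => // x Ax; apply: contrapT => nOx;
    have : (A `\` O) x by []; rewrite AO.
have [p [_ clp]] := compactT FF filterT.
have DOp : (\bigcap_(A in D) A) p.
  move=> A DA; apply: (clD A DA) => B nB.
  have [|q [[Aq _] Bq]] := clp (A `\` O) B _ nB; first by exists A.
  by exists q.
have [A DA] := D0.
have [|q [[_ nOq] Oq]] := clp (A `\` O) O _ (open_nbhs_nbhs (conj oO (DO _ DOp))).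
  by exists A.
exact: nOq.
Qed.

End CompactSpaces.

Section TopologicalGroups.
Variable G : topologicalGroupType.
Implicit Types (A B H L W : set G) (x y z : G).
Local Open Scope group_scope.

Lemma cvg_mulg (I : Type) (F : set_system I) (f g : I -> G) x y : Filter F ->
  f @ F --> x -> g @ F --> y -> (fun i => f i * g i) @ F --> x * y.
Proof.
move=> FF fx gy.
apply: (@cvg_comp _ _ _ (fun i => (f i, g i)) (fun z : G * G => z.1 * z.2)
  F (nbhs (x, y)) (nbhs (x * y))); last first.
  exact: (@mulg_continuous G (x, y)).
exact: cvg_pair.
Qed.

Lemma cvg_invg (I : Type) (F : set_system I) (f : I -> G) x : Filter F ->
  f @ F --> x -> (fun i => (f i)^-1) @ F --> x^-1.
Proof.
by move=> FF fx; apply: (cvg_comp _ _ fx); exact: (@invg_continuous G x).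
Qed.

Lemma mulgl_continuous x : continuous (fun y => x * y).
Proof. by apply: mulg_fun_continuous => z; [exact: cvg_cst|exact: cvg_id]. Qed.

Definition is_subgroup H := H 1 /\ forall x y, H x -> H y -> H (x * y^-1).

Definition is_normal H := forall x y, H x -> H (y^-1 * x * y).

Lemma subgroupV H x : is_subgroup H -> H x -> H x^-1.
Proof. by move=> [H1 HF] Hx; have := HF _ _ H1 Hx; rewrite mul1g. Qed.

Lemma subgroupM H x y : is_subgroup H -> H x -> H y -> H (x * y).
Proof.
by move=> sH Hx Hy; have := sH.2 _ _ Hx (subgroupV sH Hy); rewrite invgK.
Qed.

Lemma subgroupX H x n : is_subgroup H -> H x -> H (x ^+ n).
Proof.
move=> sH Hx; elim: n => [|n IH]; first by rewrite expg0; exact: sH.1.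
by rewrite expgS; exact: subgroupM.
Qed.

Lemma subgroupI A B : is_subgroup A -> is_subgroup B -> is_subgroup (A `&` B).
Proof.
by move=> [A1 AF] [B1 BF]; split=> // x y [? ?] [? ?]; split; [exact: AF|exact: BF].
Qed.

Lemma subgroup_bigcap (I : Type) (D : set I) (H : I -> set G) :
  (forall i, D i -> is_subgroup (H i)) -> is_subgroup (\bigcap_(i in D) H i).
Proof.
move=> sH; split=> [i Di|x y Hx Hy i Di]; first exact: (sH i Di).1.
by apply: (sH i Di).2; [exact: Hx|exact: Hy].
Qed.

Lemma normalV L x y : is_normal L -> L x -> L (y * x * y^-1).
Proof. by move=> nL Lx; have := nL x y^-1 Lx; rewrite invgK. Qed.

Definition setMg A B : set G := [set z | exists x y, [/\ A x, B y & z = x * y]].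

Lemma setMg_subl A B : B 1 -> A `<=` setMg A B.
Proof. by move=> B1 x Ax; exists x, 1; rewrite mulg1. Qed.

Lemma setMg_subr A B : A 1 -> B `<=` setMg A B.
Proof. by move=> A1 x Bx; exists 1, x; rewrite mul1g. Qed.

Lemma subgroup_setMg A L : is_subgroup A -> is_subgroup L -> is_normal L ->
  is_subgroup (setMg A L).
Proof.
move=> sA sL nL; split; first by exists 1, 1; split; [exact: sA.1|exact: sL.1|rewrite mulg1].
move=> _ _ [a [l [Aa Ll ->]]] [b [m [Ab Lm ->]]].
exists (a * b^-1), (b * (l * m^-1) * b^-1); split.
- exact: sA.2.
- by apply: normalV => //; exact: sL.2.
- by rewrite invgM !mulgA mulgVK.
Qed.

Lemma normal_setMg A L : is_normal A -> is_normal L -> is_normal (setMg A L).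
Proof.
move=> nA nL _ y [a [l [Aa Ll ->]]].
exists (y^-1 * a * y), (y^-1 * l * y); split; [exact: nA|exact: nL|].
by rewrite !mulgA mulgK.
Qed.

Lemma nbhs_mulgl x A : nbhs x A <-> nbhs 1 [set y | A (x * y)].
Proof.
split=> nA.
  by have := @mulgl_continuous x 1 A; rewrite mulg1 => /(_ nA).
have := @mulgl_continuous x^-1 x [set y | A (x * y)]; rewrite mulVg => /(_ nA) h.
have : nbhs x [set y | A (x * (x^-1 * y))] by [].
by under eq_fun do rewrite mulVKg.
Qed.

(** Applied below to an open subgroup and to its complement, both unions of left cosets: open
    subgroups are clopen. *)
Lemma open_subgroup_nbhs x A H : is_subgroup H -> nbhs 1 H ->
  A x -> (forall y h, A y -> H h -> A (y * h)) -> nbhs x A.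
Proof.
by move=> sH nH Ax AH; apply/nbhs_mulgl; apply: filterS nH => h Hh; exact: AH.
Qed.

Lemma nbhs_open H : is_subgroup H -> nbhs 1 H -> open H.
Proof.
move=> sH nH; rewrite openE => x Hx.
by apply: (open_subgroup_nbhs sH) => // y h; exact: subgroupM.
Qed.

Lemma nbhs_closed H : is_subgroup H -> nbhs 1 H -> closed H.
Proof.
move=> sH nH; rewrite -[H]setCK; apply: open_closedC; rewrite openE => x nHx.
apply: (open_subgroup_nbhs sH) => // y h nHy Hh Hyh; apply: nHy.
by have := subgroupM sH Hyh (subgroupV sH Hh); rewrite mulgK.
Qed.

Lemma nbhs_mulg U : nbhs (1 : G) U ->
  exists2 V, nbhs 1 V & forall x y, V x -> V y -> U (x * y).
Proof.
move=> nU; have := @mulg_continuous G (1, 1) U; rewrite /= mulg1 => /(_ nU).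
case=> -[A B] /= [nA nB] AB; exists (A `&` B); first exact: filterI.
by move=> x y [Ax _] [_ By]; exact: (AB (x, y)).
Qed.

Lemma nbhs_invg U : nbhs (1 : G) U -> nbhs (1 : G) [set x | U x^-1].
Proof. by move=> nU; apply: (@invg_continuous G 1 U); rewrite invg1. Qed.

Variable alpha : continuousHom G G.

Lemma chom1 : alpha 1 = 1. Proof. exact: gmulf1. Qed.

Lemma chomM x y : alpha (x * y) = alpha x * alpha y. Proof. exact: gmulfM. Qed.

Lemma chomV x : alpha x^-1 = (alpha x)^-1. Proof. exact: gmulfV. Qed.

Lemma chomF x y : alpha (x * y^-1) = alpha x * (alpha y)^-1.
Proof. exact: gmulfF. Qed.

Lemma iter_chom1 n : iter n alpha 1 = 1.
Proof. by elim: n => //= n ->; exact: chom1. Qed.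

Lemma iter_chomM n x y : iter n alpha (x * y) = iter n alpha x * iter n alpha y.
Proof. by elim: n => //= n ->; exact: chomM. Qed.

Lemma iter_chomV n x : iter n alpha x^-1 = (iter n alpha x)^-1.
Proof. by elim: n => //= n ->; exact: chomV. Qed.

Lemma iter_chom_continuous n : continuous (iter n alpha).
Proof.
elim: n => [|n IH] x; first exact: cvg_id.
by apply: (continuous_comp (IH x)); exact: cts_fun.
Qed.

End TopologicalGroups.

(** * Noetherian subgroups *)

Section NoetherianSubgroups.
Variable G : topologicalGroupType.
Hypothesis hausdorffG : hausdorff_space G.
Hypothesis compactG : compact [set: G].
Implicit Types (A B H L W : set G) (x y z : G).
Local Open Scope group_scope.
Local Notation G0 := (@identity_component G).

Lemma closed_is_compact A : closed A -> compact A.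
Proof. by move=> cA; apply: (subclosed_compact cA compactG). Qed.

Lemma closed_setMg A B : closed A -> closed B -> closed (setMg A B).
Proof.
move=> cA cB; apply: (compact_closed hausdorffG).
have -> : setMg A B = (fun z : G * G => z.1 * z.2) @` (A `*` B).
  apply/seteqP; split=> [z [x [y [Ax By ->]]]|z [[x y] [/= Ax By] <-]].
    by exists (x, y).
  by exists x, y.
apply: continuous_compact; last by apply: compact_setX; exact: closed_is_compact.
by apply: continuous_subspaceT; exact: (@mulg_continuous G).
Qed.

Lemma closed_image (f : G -> G) A : continuous f -> closed A -> closed (f @` A).
Proof.
move=> cf cA; apply: (compact_closed hausdorffG).
by apply: continuous_compact; [exact: continuous_subspaceT|exact: closed_is_compact].
Qed.

Lemma closed_preimage (f : G -> G) A : continuous f -> closed A -> closed (f @^-1` A).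
Proof. by move=> cf; apply: preimage_closed => x _; exact: cf. Qed.

Lemma identity_component_subgroup : is_subgroup G0.
Proof.
by split; [exact: identity_component1|move=> x y; exact: identity_component_div].
Qed.

Lemma identity_component_normal : is_normal G0.
Proof.
move=> x y Gx.
have cf : continuous (fun z : G => y^-1 * z * y).
  by apply: mulg_fun_continuous => z; [exact: mulgl_continuous|exact: cvg_cst].
have cA : connected ((fun z : G => y^-1 * z * y) @` G0).
  apply: connected_continuous_connected; first exact: component_connected.
  by apply: continuous_subspaceT.
apply: (connected_sub_identity_component _ cA); last by exists x.
by exists 1; [exact: identity_component1|rewrite mulg1 mulVg].
Qed.

Lemma identity_component_closed : closed G0.
Proof. by apply: component_closed; exact: closedT. Qed.

Let open_subgroups : set (set G) := [set W | is_subgroup W /\ nbhs 1 W].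

Let open_subgroups_directed (O : set G) : open O ->
  \bigcap_(W in open_subgroups) W `<=` O ->
  exists W, [/\ is_subgroup W, nbhs 1 W & W `<=` O].
Proof.
move=> oO QO.
have [|A B [sA nA] [sB nB]|W [sW nW]|W [sW nW] WO] :=
    @compact_directed G compactG open_subgroups O _ _ _ oO QO.
- by exists setT; split; [split|exact: filterT].
- exists (A `&` B) => //; split; [exact: subgroupI|exact: filterI].
- exact: nbhs_closed.
- by exists W.
Qed.

(* For a clopen set C the g with Cg = C form an open subgroup. *)
Lemma bigcap_open_subgroups_sub : \bigcap_(W in open_subgroups) W `<=` G0.
Proof.
set Q := \bigcap_(W in _) W.
have sQ : is_subgroup Q by apply: subgroup_bigcap => W [].
have cQ : closed Q by apply: closed_bigI => W [sW nW]; exact: nbhs_closed.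
have clopenQ B : (exists2 C, open C & B = Q `&` C) ->
    (exists2 C, closed C & B = Q `&` C) -> B 1 -> B = Q.
  move=> [C oC BC] [C' cC' BC'] B1.
  have cB : closed B by rewrite BC'; exact: closedI.
  have cB' : closed (Q `&` ~` C) by apply: closedI => //; exact: open_closedC.
  have BB' : B `&` (Q `&` ~` C) = set0.
    by rewrite BC -subset0 => x [[_ Cx] [_ nCx]].
  have [P [P' [oP oP' BP BP' PP']]] :=
    (@normal_openP Rdefinitions.R G).1 (compact_normal hausdorffG compactG)
      _ _ cB cB' BB'.
  (* Compactness puts an open subgroup [W] inside the union of [P] and [P'], so that [W] meets [P]
     in a set clopen in G, not only relatively to [Q]. *)
  have [|W [sW nW WP]] := @open_subgroups_directed (P `|` P') (openU oP oP').
    move=> x Qx; have [Cx|nCx] := pselect (C x); last by right; exact: BP'.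
    by left; apply: BP; rewrite BC.
  pose C0 := W `&` P.
  have oC0 : open C0 by apply: openI => //; exact: nbhs_open.
  have cC0 : closed C0.
    have -> : C0 = W `&` ~` P'.
      apply/seteqP; split=> x [Wx Px]; split=> //.
        by move=> P'x; have : (P `&` P') x by []; rewrite PP'.
      by have [] := WP _ Wx.
    by apply: closedI; [exact: nbhs_closed|exact: open_closedC].
  (* The right multiplications mapping [C0] into itself form a neighbourhood of 1, because [C0] is
     compact and open. The open subgroup of the g with g and g^-1 in [St] contains [Q]; as 1 lies in
     [C0], so does [Q]. *)
  pose St := [set g | forall c, C0 c -> C0 (c * g)].
  have nSt : nbhs 1 St.
    have /compact_near_coveringP := closed_is_compact cC0.
    move=> /(_ G (nbhs (1 : G)) (fun g c => C0 (c * g))); apply => c C0c.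
    have := @mulg_continuous G (c, 1) C0; rewrite /= mulg1; apply.
    exact: open_nbhs_nbhs.
  have sS : is_subgroup (St `&` [set g | St g^-1]).
    split; first by split=> c; rewrite ?invg1 mulg1.
    move=> x y [Sx Sx'] [Sy Sy']; split=> c C0c.
      by rewrite mulgA; apply: Sy'; exact: Sx.
    by rewrite invgF mulgA; apply: Sx'; exact: Sy.
  have QC0 x : Q x -> P x.
    move=> Qx.
    have [Sx _] := Qx _ (conj sS (filterI nSt (nbhs_invg nSt))).
    have [|_] := Sx 1; last by rewrite mul1g.
    by split; [exact: sW.1|exact: BP].
  rewrite BC; apply/seteqP; split=> [x []//|x Qx]; split=> //.
  apply: contrapT => nCx; have : (P `&` P') x by split; [exact: QC0|exact: BP'].
  by rewrite PP'.
apply: connected_sub_identity_component; first exact: sQ.1.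
move=> B [b Bb] [C oC BC] [C' cC' BC'].
have [B1|nB1] := pselect (B 1).
  by apply: clopenQ => //; [exists C|exists C'].
(* If 1 is not in [B], the relative complement of [B] is clopen and contains 1, so it is all of [Q],
   contradicting [B b]. *)
have QCC' : Q `&` ~` C = Q `&` ~` C'.
  apply/seteqP; split=> x [Qx nCx]; split=> // C'x; apply: nCx.
    by have : (Q `&` C') x by []; rewrite -BC' BC => -[].
  by have : (Q `&` C) x by []; rewrite -BC BC' => -[].
suff E : Q `&` ~` C = Q.
  have [Qb Cb] : (Q `&` C) b by rewrite -BC.
  by move: Qb; rewrite -E => -[].
apply: clopenQ.
- by exists (~` C') => //; exact: closed_openC.
- by exists (~` C) => //; exact: open_closedC.
- by split; [exact: sQ.1|move=> C1; apply: nB1; rewrite BC; split=> //; exact: sQ.1].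
Qed.

Lemma open_subgroup_around (O : set G) : open O -> G0 `<=` O ->
  exists W, [/\ is_subgroup W, nbhs 1 W & W `<=` O].
Proof.
move=> oO GO; apply: open_subgroups_directed => //.
exact: subset_trans bigcap_open_subgroups_sub GO.
Qed.

(** For compact Hausdorff G this means that G/L is a Lie group. The chain condition is phrased with
    subgroups of G above L, so that no quotient has to be formed. *)
Definition noetherian L := [/\ is_subgroup L, is_normal L, closed L &
  forall H : nat -> set G, (forall n, is_subgroup (H n)) ->
    (forall n, closed (H n)) -> (forall n, L `<=` H n) ->
    (forall n, H n.+1 `<=` H n) ->
  exists n0, forall n, (n0 <= n)%N -> H n0 `<=` H n].

Lemma chain_sub (H : nat -> set G) : (forall n, H n.+1 `<=` H n) ->
  forall m n, (m <= n)%N -> H n `<=` H m.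
Proof.
move=> dH m n /subnK <-; elim: (n - m)%N => [//|k IH].
by rewrite addSn; exact: subset_trans IH.
Qed.

Lemma noetherianS L L' : noetherian L -> L `<=` L' ->
  is_subgroup L' -> is_normal L' -> closed L' -> noetherian L'.
Proof.
move=> [_ _ _ dcc] LL' sL' nL' cL'; split=> // H sH cH LH dH.
by apply: dcc => // n; exact: subset_trans (LH n).
Qed.

(** As for modules: the chains H_n L and (H_n ∩ L) M become stationary, and together they control
    H_n, because H_n contains L ∩ M. An element h of an early term is h' l with h' in H_n, and then
    l = l' m with l' in H_n and m in L ∩ M. *)
Lemma noetherianI L M : noetherian L -> noetherian M -> noetherian (L `&` M).
Proof.
move=> [sL nL cL dL] [sM nM cM dM]; split.
- exact: subgroupI.
- by move=> x y [Lx Mx]; split; [exact: nL|exact: nM].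
- exact: closedI.
move=> H sH cH LH dH.
have [|n|n|n|n1 E1] := dL (fun n => setMg (H n) L).
- by move=> n; exact: subgroup_setMg.
- exact: closed_setMg.
- by apply: setMg_subr; exact: (sH n).1.
- by move=> _ [x [y [Hx Ly ->]]]; exists x, y; split=> //; exact: dH.
have [|n|n|n|n2 E2] := dM (fun n => setMg (H n `&` L) M).
- by move=> n; apply: subgroup_setMg => //; exact: subgroupI.
- by apply: closed_setMg => //; exact: closedI.
- by apply: setMg_subr; split; [exact: (sH n).1|exact: sL.1].
- by move=> _ [x [y [[Hx Lx] My ->]]]; exists x, y; split=> //; split=> //; exact: dH.
exists (maxn n1 n2) => n; rewrite geq_max => /andP[n1n n2n] h Hh.
have Hn1 : H n1 h by apply: chain_sub Hh => //; exact: leq_maxl.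
have [h' [l [Hh' Ll hE]]] := E1 _ n1n _ (setMg_subl sL.1 Hn1).
have lE : l = h'^-1 * h by rewrite hE mulKg.
have Hl : H n2 l.
  rewrite lE; apply: subgroupM => //.
    by apply: subgroupV => //; apply: chain_sub Hh'.
  by apply: chain_sub Hh => //; exact: leq_maxr.
have [l' [m [[Hl' Ll'] Mm lE']]] := E2 _ n2n _ (setMg_subl sM.1 (conj Hl Ll)).
rewrite hE; apply: subgroupM => //; rewrite lE'; apply: subgroupM => //.
apply: LH; split=> //.
have -> : m = l'^-1 * l by rewrite lE' mulKg.
by apply: subgroupM => //; exact: subgroupV.
Qed.

(** The chain of the groups alpha(H_n) L becomes stationary, and H_n is recovered from it since it
    contains the preimage of L. *)
Lemma noetherian_preimage (alpha : continuousHom G G) L :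
  noetherian L -> noetherian (alpha @^-1` L).
Proof.
move=> [sL nL cL dL].
have calpha : continuous alpha by exact: cts_fun.
split.
- split; first by rewrite /preimage /= chom1; exact: sL.1.
  by move=> x y Lx Ly; rewrite /preimage /= chomF; exact: sL.2.
- by move=> x y Lx; rewrite /preimage /= !chomM chomV; exact: nL.
- exact: closed_preimage.
move=> H sH cH LH dH.
have [n|n|n|n|n1 E1] := dL (fun n => setMg (alpha @` H n) L).
- apply: subgroup_setMg => //; split; first by exists 1; [exact: (sH n).1|exact: chom1].
  move=> _ _ [x Hx <-] [y Hy <-]; exists (x * y^-1); last exact: chomF.
  exact: (sH n).2.
- by apply: closed_setMg => //; exact: closed_image.
- by apply: setMg_subr; exists 1; [exact: (sH n).1|exact: chom1].
- move=> _ [_ [y [[x Hx <-] Ly ->]]]; exists (alpha x), y; split=> //.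
  by exists x => //; exact: dH.
exists n1 => n n1n h Hh.
have [|_ [l [[h' Hh' <-] Ll hE]]] := E1 _ n1n (alpha h).
  by apply: setMg_subl; [exact: sL.1|exists h].
rewrite -[h](mulVKg h'); apply: subgroupM => //; apply: LH.
by rewrite /preimage /= chomM chomV hE mulKg.
Qed.

(** If G0 L is not a neighbourhood of 1, every open subgroup W above L contains some x outside G0 L.
    The coset x L misses G0, hence misses some open subgroup W', and W ∩ W' L is a strictly smaller
    open subgroup above L. Iterating contradicts the chain condition. *)
Lemma noetherian_nbhs L : noetherian L -> nbhs 1 (setMg G0 L).
Proof.
move=> [sL nL cL dL]; apply: contrapT => nGL.
pose P W := [/\ is_subgroup W, nbhs 1 W & L `<=` W].
pose R (W W' : {W | P W}) := sval W' `<=` sval W /\ ~ (sval W `<=` sval W').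
have step (W : {W | P W}) : {W' | R W W'}.
  apply: cid; case: W => W [sW nW LW].
  have [x [Wx nGLx]] : exists x, W x /\ ~ setMg G0 L x.
    apply: contrapT => nex; apply: nGL; apply: filterS nW => x Wx.
    by apply: contrapT => nx; apply: nex; exists x.
  have [||W' [sW' nW' WO]] := @open_subgroup_around (~` [set y | L (x^-1 * y)]).
  - by apply: closed_openC; apply: (closed_preimage _ cL); exact: mulgl_continuous.
  - move=> y Gy /= Ly; apply: nGLx; exists y, (x^-1 * y)^-1; split=> //.
      exact: subgroupV.
    by rewrite invgM invgK mulVKg.
  have LW' : L `<=` setMg W' L by apply: setMg_subr; exact: sW'.1.
  have PW' : P (W `&` setMg W' L).
    split.
    - by apply: subgroupI => //; exact: subgroup_setMg.
    - by apply: filterI => //; apply: filterS nW'; exact: setMg_subl sL.1.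
    - by move=> y Ly; split; [exact: LW|exact: LW'].
  exists (exist P _ PW'); split; first exact: subIsetl.
  move=> /= /(_ x Wx) [_ [w [l [Ww Ll xE]]]]; apply: (WO _ Ww) => /=.
  by rewrite xE invgM mulgVK; exact: subgroupV.
have PT : P setT by split; [split|exact: filterT|].
have [f [_ Rf]] := dependent_choice step (exist P _ PT).
have [n|n|n|n|n0 /(_ n0.+1 (leqnSn _))] := dL (fun n => sval (f n)).
- by case: (f n) => W [].
- by case: (f n) => W [] /= sW nW _; exact: nbhs_closed.
- by case: (f n) => W [].
- exact: (Rf n).1.
- exact: (Rf n0).2.
Qed.

End NoetherianSubgroups.

(** * Limits along ultrafilters *)

Section UltrafilterLimits.
Variables (R : realType) (I : Type) (F : set_system I).
Hypothesis ultraF : UltraFilter F.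
Local Open Scope ring_scope.
Import Order.TTheory GRing.Theory Num.Theory numFieldNormedType.Exports.

Lemma ultra_cvg_compact (T : topologicalType) (A : set T) (f : I -> T) :
  compact A -> (\forall i \near F, A (f i)) -> exists2 x : T, A x & f @ F --> x.
Proof.
move=> cA FA; have [x [Ax clx]] := cA (f @ F) (fmap_proper_filter _ _) FA.
exists x => // B nB; have [//|FnB] := in_ultra_setVsetC (f @^-1` B) ultraF.
by have [y [nBy By]] := clx (~` B) B FnB nB.
Qed.

Lemma ultra_cvg_bounded (f : I -> R) (c : R) :
  (\forall i \near F, `|f i| <= c) -> exists l : R, f @ F --> l.
Proof.
move=> fc; have [|l _ fl] := @ultra_cvg_compact R `[-c, c] f (@segment_compact R (- c) c).
  by apply: filterS fc => i fic; rewrite /= in_itv /= -ler_norml.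
by exists l.
Qed.

Variable T : topologicalType.
Hypothesis compactT : compact [set: T].

Definition equi (B : set (T -> R)) := forall x (e : R), 0 < e ->
  \forall y \near x, forall f, B f -> `|f y - f x| <= e.

(** Arzelà-Ascoli along an ultrafilter: pointwise limits exist by boundedness, the limit inherits
    the equicontinuity estimates, and compactness makes the convergence uniform. *)
Lemma ultra_equicontinuous (B : set (T -> R)) (f : I -> T -> R) (c : R) :
  equi B -> (\forall i \near F, B (f i)) ->
  (\forall i \near F, forall x, `|f i x| <= c) ->
  exists2 l : T -> R, continuous l &
    forall e : R, 0 < e -> \forall i \near F, forall x, `|f i x - l x| <= e.
Proof.
move=> eB FB fc.
have /boolp.choice[l fl] : forall x, exists l : R, (fun i => f i x) @ F --> l.
  move=> x; apply: (@ultra_cvg_bounded _ c).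
  by apply: filterS fc => i; apply.
have near_l (e : R) x : 0 < e -> \forall i \near F, `|f i x - l x| <= e.
  move=> e0; have /cvgrPdist_le /(_ e e0) := fl x.
  by apply: filterS => i; rewrite distrC.
have el x (e : R) : 0 < e -> \forall y \near x, `|l y - l x| <= e.
  move=> e0; have e3 : 0 < e / 3 by rewrite divr_gt0.
  apply: filterS (eB x _ e3) => y Hy.
  have [i [[Bi ly] lx]] :=
    filter_ex (filterI (filterI FB (near_l _ y e3)) (near_l _ x e3)).
  have := Hy _ Bi; move: ly lx; rewrite !ler_norml => /andP[? ?] /andP[? ?] /andP[? ?].
  by apply/andP; split; lra.
exists l.
  move=> x; apply/cvgrPdist_le => e e0.
  by apply: filterS (el x e e0) => y; rewrite distrC.
move=> e e0; have e3 : 0 < e / 3 by rewrite divr_gt0.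
have /compact_near_coveringP /(_ I F (fun i x => `|f i x - l x| <= e) _) := compactT.
move=> cov; apply: filterS (cov _) => [i H x|x _]; first exact: H.
exists ([set y | (forall g, B g -> `|g y - g x| <= e / 3) /\ `|l y - l x| <= e / 3],
        [set i | B (f i) /\ `|f i x - l x| <= e / 3]).
  by split; apply: filterI; [exact: eB|exact: el|exact: FB|exact: near_l].
move=> [y i] /= [[By ly] [Bi lx]].
have := By _ Bi; move: ly lx; rewrite !ler_norml => /andP[? ?] /andP[? ?] /andP[? ?].
by apply/andP; split; lra.
Qed.

Lemma ultra_cauchy (B : set (T -> R)) (f : I -> T -> R) (c e : R) :
  equi B -> (\forall i \near F, B (f i)) ->
  (\forall i \near F, forall x, `|f i x| <= c) -> 0 < e ->
  exists2 A, F A & forall i j x, A i -> A j -> `|f i x - f j x| <= e.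
Proof.
move=> eB FB fc e0.
have [l _ /(_ (e / 2))] := ultra_equicontinuous eB FB fc.
rewrite divr_gt0// => /(_ isT) Fe.
exists [set i | forall x, `|f i x - l x| <= e / 2] => // i j x /(_ x) fi /(_ x) fj.
by move: fi fj; rewrite !ler_norml => /andP[? ?] /andP[? ?]; apply/andP; split; lra.
Qed.

End UltrafilterLimits.

(** * Haar mean *)

Section ContinuousFunctions.
Variables (R : realType) (T : topologicalType).
Local Open Scope ring_scope.
Import Order.TTheory GRing.Theory Num.Theory numFieldNormedType.Exports.
Implicit Types f g : T -> R.

Lemma cfD f g : continuous f -> continuous g -> continuous (fun x => f x + g x).
Proof. by move=> cf cg x; apply: cvgD; [exact: cf|exact: cg]. Qed.

Lemma cfM f g : continuous f -> continuous g -> continuous (fun x => f x * g x).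
Proof. by move=> cf cg x; apply: cvgM; [exact: cf|exact: cg]. Qed.

Lemma cfC (c : R) : continuous (fun _ : T => c).
Proof. by move=> x; exact: cvg_cst. Qed.

Lemma cfZ (c : R) f : continuous f -> continuous (fun x => c * f x).
Proof. by move=> cf; apply: cfM => //; exact: cfC. Qed.

Lemma cfB f g : continuous f -> continuous g -> continuous (fun x => f x - g x).
Proof. by move=> cf cg x; apply: cvgB; [exact: cf|exact: cg]. Qed.

Lemma cf_sum (I : Type) (s : seq I) (F : I -> T -> R) :
  (forall i, continuous (F i)) -> continuous (fun x => \sum_(i <- s) F i x).
Proof.
move=> cF; elim: s => [|i s IH].
  by under eq_fun do rewrite big_nil; exact: cfC.
by under eq_fun do rewrite big_cons; exact: cfD.
Qed.

Lemma cf_comp (S : topologicalType) f (h : S -> T) :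
  continuous f -> continuous h -> continuous (fun x => f (h x)).
Proof. by move=> cf ch x; apply: (continuous_comp (ch x)); exact: cf. Qed.

Lemma cf_pairl (S : topologicalType) (F : S -> T -> R) s :
  continuous (fun z : S * T => F z.1 z.2) -> continuous (F s).
Proof.
move=> cF x; apply: (@continuous_comp _ _ _ (fun x => (s, x)) (fun z => F z.1 z.2)).
  by apply: cvg_pair; [exact: cvg_cst|exact: cvg_id].
exact: cF.
Qed.

Lemma cf_swap (S : topologicalType) (F : S -> T -> R) :
  continuous (fun z : S * T => F z.1 z.2) ->
  continuous (fun z : T * S => F z.2 z.1).
Proof.
move=> cF z; apply: (@continuous_comp _ _ _ (fun z => (z.2, z.1)) (fun z => F z.1 z.2)).
  by apply: cvg_pair; [exact: cvg_snd|exact: cvg_fst].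
exact: cF.
Qed.

Hypothesis compactT : compact [set: T].

Lemma cf_bounded f : continuous f -> exists2 c : R, 0 < c & forall x, `|f x| <= c.
Proof.
move=> cf; have : compact (f @` setT).
  by apply: continuous_compact => //; exact: continuous_subspaceT.
move=> /compact_bounded [c [_ fc]]; exists (`|c| + 1); first by rewrite ltr_wpDl.
by move=> x; apply: fc => //; rewrite (le_lt_trans (ler_norm c))// ltrDl.
Qed.

(** Tube lemma: compactness of [T] turns the estimates near each point (s, x) into one that is
    uniform in x. *)
Lemma cf_tube (S : topologicalType) (F : S -> T -> R) :
  continuous (fun z : S * T => F z.1 z.2) ->
  forall s (e : R), 0 < e -> \forall s' \near s, forall x, `|F s' x - F s x| <= e.
Proof.
move=> cF s e e0.
have /compact_near_coveringP := compactT.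
move=> /(_ S (nbhs s) (fun s' x => `|F s' x - F s x| <= e) _) cov.
apply: filterS (cov _) => [s' H x|x _]; first exact: H.
have e2 : 0 < e / 2 by rewrite divr_gt0.
have /cvgrPdist_le /(_ _ e2) [[A B] /= [nA nB] AB] := cF (s, x).
exists (B, A) => // -[x' s'] /= [Bx' As'].
have := AB (s', x') (conj As' Bx').
have := AB (s, x') (conj (nbhs_singleton nA) Bx') => /=.
by rewrite !ler_norml => /andP[? ?] /andP[? ?]; apply/andP; split; lra.
Qed.

End ContinuousFunctions.

(** * Construction of an invariant mean from finite averages *)

Section HaarMean.
Variables (R : realType) (G : topologicalGroupType).
Hypothesis compactG : compact [set: G].
Local Open Scope ring_scope.
Import Order.TTheory GRing.Theory Num.Theory numFieldNormedType.Exports.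
Implicit Types (f g : G -> R) (s : seq G) (U V : set G).

(** The normalised left Haar integral as a functional, without measures. [M] is total, but apart
    from constants the axioms only concern continuous functions. Fubini's theorem is included
    because it can be read off from the construction by finite averages. *)
Record haar_mean (M : (G -> R) -> R) : Prop := HaarMean {
  mean_lin : forall a f g, continuous f -> continuous g ->
    M (fun x => a * f x + g x) = a * M f + M g;
  mean_le : forall f g, continuous f -> continuous g ->
    (forall x, f x <= g x) -> M f <= M g;
  mean_cst : forall c, M (fun=> c) = c;
  mean_inv : forall (h : G) f, continuous f -> M (fun x => f (h * x)%g) = M f;
  mean_fubini : forall F : G -> G -> R,
    continuous (fun z : G * G => F z.1 z.2) ->
    M (fun x => M (F x)) = M (fun y => M (F ^~ y)) }.

Definition avg s f : R := (size s)%:R^-1 * \sum_(x <- s) f x.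

Lemma avg_lin s a f g : avg s (fun x => a * f x + g x) = a * avg s f + avg s g.
Proof. by rewrite /avg big_split -mulr_sumr /= mulrDr mulrCA. Qed.

Lemma avg_le s f g : (forall x, f x <= g x) -> avg s f <= avg s g.
Proof.
by move=> fg; rewrite ler_wpM2l ?invr_ge0 ?ler0n// ler_sum.
Qed.

Lemma avg_cst s c : (0 < size s)%N -> avg s (fun=> c) = c.
Proof.
move=> s0; rewrite /avg big_const_seq count_predT iter_addr_0 -[c *+ _]mulr_natl mulKf//.
by rewrite pnatr_eq0 -lt0n.
Qed.

Lemma avg_dist s f g (e : R) : (0 < size s)%N -> (forall x, `|f x - g x| <= e) ->
  `|avg s f - avg s g| <= e.
Proof.
move=> s0 fg; rewrite ler_distl.
(* The constant [e] is written [1 * (fun=> e) x] to match [avg_lin]. *)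
have : avg s f <= avg s (fun x => 1 * (fun=> e) x + g x).
  by apply: avg_le => x; have := fg x; rewrite ler_distl mul1r => /andP[? ?]; lra.
have : avg s g <= avg s (fun x => 1 * (fun=> e) x + f x).
  by apply: avg_le => x; have := fg x; rewrite ler_distl mul1r => /andP[? ?]; lra.
by rewrite !avg_lin avg_cst// mul1r => ? ?; apply/andP; split; lra.
Qed.

Definition covers U s := forall z, exists2 x, x \in s & U (x^-1 * z)%g.

(** The complements [C s] of finite unions of translates are closed and directed, and have no common
    point because z lies in z V. By compactness one of them is empty. *)
Lemma covers_exists U : nbhs (1 : G)%g U -> exists s, covers U s.
Proof.
rewrite nbhsE => -[V [oV V1] VU].
pose C s := [set z | forall x, x \in s -> ~ V (x^-1 * z)%g].
have [||||A [s _ <-] s0] :=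
    @compact_directed G compactG [set C s | s in setT] set0 _ _ _ open0.
- by exists (C [::]); exists [::].
- move=> _ _ [s _ <-] [t _ <-]; exists (C (s ++ t)); first by exists (s ++ t).
  by move=> z Cz; split=> x xs; apply: Cz; rewrite mem_cat xs ?orbT.
- move=> _ [s _ <-].
  have -> : C s = \bigcap_(x in [set x | x \in s]) ((fun z => x^-1 * z)%g @^-1` ~` V).
    by apply/seteqP; split=> z Cz x; exact: Cz.
  apply: closed_bigI => x _; apply: closed_preimage; first exact: mulgl_continuous.
  exact: open_closedC.
- move=> z Cz; have := Cz (C [:: z]) (ex_intro2 _ _ [:: z] I erefl) z (mem_head _ _).
  by rewrite mulVg; apply.
- exists s => z; apply: contrapT => nz; apply: (s0 z) => x xs Vx.
  by apply: nz; exists x => //; exact: VU.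
Qed.

(* A cover by a minimal number of translates of U and any of its left
   translates are matched by the marriage theorem, so that the average over the
   cover is almost invariant. *)
Lemma almost_invariant_average U : nbhs (1 : G)%g U ->
  exists2 s, (0 < size s)%N & forall (h : G) f (e : R),
    (forall x y z, U (x^-1 * z)%g -> U (y^-1 * z)%g -> `|f x - f y| <= e) ->
    `|avg s f - avg s (fun x => f (h * x)%g)| <= e.
Proof.
move=> nU.
pose P n := `[< exists2 s, size s = n & covers U s >].
have exP : exists n, P n.
  by have [s cs] := covers_exists nU; exists (size s); apply/asboolP; exists s.
case: (ex_minnP exP) => n /asboolP[s sn cs] minn.
have s0 : (0 < size s)%N by have [x] := cs 1%g; case: (s).
exists s => // h f e fe.
pose X (i : 'I_n) := nth 1%g s i.
have covX z : exists i, U ((X i)^-1 * z)%g.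
  have [x xs Ux] := cs z; have xn : (index x s < n)%N by rewrite -sn index_mem.
  by exists (Ordinal xn); rewrite /X /= nth_index.
(* [i] may be matched with [j] when the translate of [U] by [X i] meets the one by [h * X j]; the
   values of f at these two points then differ by at most [e]. *)
pose r (i : 'I_n) := finset.finset (fun j : 'I_n =>
  `[< exists z, U ((X i)^-1 * z)%g /\ U ((h * X j)^-1 * z)%g >]).
have n0 : (0 < n)%N by rewrite -sn.
have [A _|m [mI mr]] := @hall_marriage _ _ (Ordinal n0) (finset.setTfor _) r.
  rewrite leqNgt; apply/negP => ltNA.
  pose N := [seq j <- enum 'I_n | `[< exists2 i, i \in A & j \in r i >]].
  (* A failure of Hall's condition at [A] would give a smaller cover, against minimality: the
     translates by [h * X j] for j in [N], and by [X i] for i outside [A]. *)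
  pose s' := [seq (h * X j)%g | j <- N] ++ [seq X i | i <- enum (predC (mem A))].
  have cs' : covers U s'.
    move=> z; have [j Uj] := covX (h^-1 * z)%g.
    have Uj' : U ((h * X j)^-1 * z)%g by rewrite invgM -mulgA.
    have [jN|jN] := boolP (j \in N).
      by exists (h * X j)%g => //; rewrite mem_cat; apply/orP; left; apply/mapP; exists j.
    have [i Ui] := covX z; exists (X i) => //; rewrite mem_cat; apply/orP; right.
    apply/mapP; exists i => //; rewrite mem_enum; apply: contraNN jN => iA.
    rewrite mem_filter mem_enum andbT; apply/asboolP; exists i => //.
    by rewrite finset.inE; apply/asboolP; exists z.
  have /minn : P (size s') by apply/asboolP; exists s'.
  rewrite size_cat !size_map -cardE leqNgt => /negP; apply.
  have nE : (#|A| + #|predC (mem A)|)%N = n by rewrite cardC card_ord.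
  rewrite -[leqRHS]nE ltn_add2r; apply: leq_ltn_trans ltNA.
  rewrite -(card_uniqP (filter_uniq _ (enum_uniq _))); apply: subset_leq_card.
  apply/fintype.subsetP => j; rewrite mem_filter => /andP[/asboolP[i iA jr] _].
  by apply/finset.bigcupP; exists i.
have avgE f' : avg s f' = n%:R^-1 * \sum_(i < n) f' (X i).
  by rewrite /avg sn (big_nth 1%g) sn big_mkord.
have mI' : injective m by move=> i j; apply: mI; rewrite finset.inE.
rewrite !avgE [X in _ - _ * X](reindex_inj mI') -mulrBr -sumrB normrM ger0_norm ?invr_ge0//.
rewrite ler_pdivrMl ?ltr0n//; apply: le_trans (ler_norm_sum _ _ _) _.
rewrite -[n in n%:R]card_ord mulr_natl -sumr_const; apply: ler_sum => i _.
have := mr i; rewrite !finset.inE => /(_ isT)/asboolP[z [Uz Uz']].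
exact: fe Uz Uz'.
Qed.

(** The mean is the limit of the almost invariant averages along an ultrafilter on sets [U] that
    contains all conditions of the form [U] small enough around 1. *)
Lemma haar_mean_exists : exists M, haar_mean M.
Proof.
have [F [ultraF sF]] :=
  @ultraFilterLemma _ (powerset_filter_from (nbhs (1%g : G))) _.
(* The singleton list is a default for sets that are not neighbourhoods of 1; it keeps all averages
   normalised. *)
have /boolp.choice[S SP] : forall U, exists s, (0 < size s)%N /\
    (nbhs (1%g : G) U -> forall (h : G) f (e : R),
    (forall x y z, U (x^-1 * z)%g -> U (y^-1 * z)%g -> `|f x - f y| <= e) ->
    `|avg s f - avg s (fun x => f (h * x)%g)| <= e).
  move=> U; have [nU|nU] := pselect (nbhs (1%g : G) U).
    by have [s s0 sP] := almost_invariant_average nU; exists s.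
  by exists [:: 1%g].
pose A U f := avg (S U) f.
have S0 U : (0 < size (S U))%N by have [] := SP U.
have Abnd U f (c : R) : (forall x, `|f x| <= c) -> `|A U f| <= c.
  move=> fc; rewrite -[A U f]subr0 -[X in _ - X](@avg_cst (S U) 0)//.
  by apply: avg_dist => // x; rewrite subr0.
have /boolp.choice[M MP] : forall f, exists l : R, continuous f ->
    (fun U => A U f) @ F --> l.
  move=> f; have [cf|ncf] := pselect (continuous f); last by exists 0.
  have [c _ fc] := cf_bounded compactG cf.
  have [|l fl] := @ultra_cvg_bounded R _ F ultraF (fun U => A U f) c.
    by apply: nearW => U; exact: Abnd.
  by exists l.
have Mlim f (l : R) : continuous f -> (fun U => A U f) @ F --> l -> M f = l.
  by move=> cf fl; apply: (cvg_unique (@Rhausdorff R) (MP f cf) fl).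
have Mnear f (e : R) : continuous f -> 0 < e -> \forall U \near F, `|A U f - M f| <= e.
  move=> cf e0; have /cvgrPdist_le /(_ e e0) := MP f cf.
  by apply: filterS => U; rewrite distrC.
have Mlin a f g : continuous f -> continuous g ->
    M (fun x => a * f x + g x) = a * M f + M g.
  move=> cf cg; apply: Mlim; first by apply: cfD => //; exact: cfZ.
  under eq_fun do rewrite /A avg_lin.
  by apply: cvgD; [apply: cvgM; [exact: cvg_cst|exact: MP]|exact: MP].
have Mle f g : continuous f -> continuous g -> (forall x, f x <= g x) -> M f <= M g.
  move=> cf cg fg.
  apply/ler_addgt0Pr => e e0; have e2 : 0 < e / 2 by rewrite divr_gt0.
  have [U []] := filter_ex (filterI (Mnear f _ cf e2) (Mnear g _ cg e2)).
  have := avg_le (S U) fg; rewrite /A !ler_norml => ? /andP[? ?] /andP[? ?]; lra.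
have Mcst c : M (fun=> c) = c.
  apply: Mlim; first exact: cfC.
  by under eq_fun do rewrite /A avg_cst//; exact: cvg_cst.
have Mdist f g (e : R) : continuous f -> continuous g ->
    (forall x, `|f x - g x| <= e) -> `|M f - M g| <= e.
  move=> cf cg fg; rewrite ler_distl.
  have : M f <= M (fun x => 1 * (fun=> e) x + g x).
    apply: Mle => [//||x]; first by apply: cfD => //; exact: cfC.
    by have := fg x; rewrite ler_distl mul1r => /andP[? ?]; lra.
  have : M g <= M (fun x => 1 * (fun=> e) x + f x).
    apply: Mle => [//||x]; first by apply: cfD => //; exact: cfC.
    by have := fg x; rewrite ler_distl mul1r => /andP[? ?]; lra.
  rewrite !Mlin ?Mcst ?mul1r//; try exact: cfC.
  by move=> ? ?; apply/andP; split; lra.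
exists M; split=> // [h f cf|E cE].
  apply/eqP; rewrite -subr_eq0 -normr_le0; apply/ler_addgt0Pr => e e0; rewrite add0r.
  have e3 : 0 < e / 3 by rewrite divr_gt0.
  have e6 : 0 < e / 6 by rewrite divr_gt0.
  have chf : continuous (fun x => f (h * x)%g).
    by apply: cf_comp => //; exact: mulgl_continuous.
  (* When translates of a small [U] by x and y share a point z, both f x and f y are within [e / 6]
     of f z, so [U] satisfies the oscillation hypothesis in [SP] with [e / 3]. *)
  have nV : \forall v \near (1%g : G), forall x, `|f (x * v)%g - f x| <= e / 6.
    have cF : continuous (fun z : G * G => f (z.2 * z.1)%g).
      apply: cf_comp => //.
      by apply: mulg_fun_continuous => z; [exact: cvg_snd|exact: cvg_fst].
    have := @cf_tube R G compactG G (fun v x => f (x * v)%g) cF 1%g _ e6.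
    by apply: filterS => v Hv x; have := Hv x; rewrite mulg1.
  have [U [[[mf mfh] UV] nU]] := filter_ex (filterI (filterI (filterI
    (Mnear _ _ cf e3) (Mnear _ _ chf e3)) (sF _ (small_set_sub nV)))
    (sF _ (@near_small_set _ (nbhs (1%g : G)) _))).
  have inv : `|avg (S U) f - avg (S U) (fun x => f (h * x)%g)| <= e / 3.
    have [_ HU] := SP U; apply: HU => // x y z Uxz Uyz.
    have := UV _ Uxz x; have := UV _ Uyz y; rewrite !mulVKg !ler_norml.
    by move=> /andP[? ?] /andP[? ?]; apply/andP; split; lra.
  move: mf mfh inv; rewrite -/(A U f) -/(A U _) !ler_norml.
  by move=> /andP[? ?] /andP[? ?] /andP[? ?]; apply/andP; split; lra.
have Mcont (K : G -> G -> R) : continuous (fun z : G * G => K z.1 z.2) ->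
    continuous (fun x => M (K x)).
  move=> cK x; apply/cvgrPdist_le => e e0.
  apply: filterS (cf_tube compactG cK x e0) => y Hy; rewrite distrC.
  by apply: Mdist => //; exact: cf_pairl.
have Mavg s (K : G -> G -> R) : continuous (fun z : G * G => K z.1 z.2) ->
    M (fun x => avg s (K x)) = avg s (fun y => M (K ^~ y)).
  move=> cK; have cK' y : continuous (K ^~ y).
    exact: (@cf_pairl _ _ _ (fun y x => K x y) y (cf_swap cK)).
  have Z f c : continuous f -> M (fun x => c * f x) = c * M f.
    move=> cf; rewrite -[RHS]addr0 -[X in _ = _ + X](Mcst 0) -Mlin//; last exact: cfC.
    by congr (M _); apply/funext => x; rewrite addr0.
  rewrite /avg Z; last exact: cf_sum.
  congr (_ * _); elim: s => [|y s IH].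
    by under eq_fun do rewrite big_nil; rewrite Mcst big_nil.
  rewrite big_cons -IH -[X in _ = X + _]mul1r -Mlin//; last exact: cf_sum.
  by congr (M _); apply/funext => x; rewrite big_cons mul1r.
have cE' := cf_swap cE.
apply/eqP; rewrite -subr_eq0 -normr_le0; apply/ler_addgt0Pr => e e0; rewrite add0r.
have e2 : 0 < e / 2 by rewrite divr_gt0.
(* The averages of [E x] converge to its mean uniformly in x, by equicontinuity, so [M] can be
   applied to them. For finite averages the exchange is the linearity [Mavg]. *)
have unif : \forall U \near F, forall x, `|A U (E x) - M (E x)| <= e / 2.
  pose B := [set g | exists U, g = fun x => A U (E x)].
  have [c Ec] : exists c, forall x y, `|E x y| <= c.
    have compactGG : compact [set: G * G] by rewrite -setXTT; exact: compact_setX.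
    have [c _ Ec] := cf_bounded compactGG cE.
    by exists c => x y; exact: (Ec (x, y)).
  have eB : equi B.
    move=> x d d0; apply: filterS (cf_tube compactG cE x d0) => y Hy _ [U ->].
    exact: avg_dist.
  have [||l _ El] := @ultra_equicontinuous R _ F ultraF G compactG B
      (fun U x => A U (E x)) c eB.
  - by apply: nearW => U; exists U.
  - by apply: nearW => U x; exact: Abnd.
  suff Ml x : M (E x) = l x by apply: filterS (El _ e2) => U + x; rewrite Ml; apply.
  apply: Mlim; first exact: cf_pairl.
  apply/cvgrPdist_le => d d0.
  by apply: filterS (El d d0) => U /(_ x); rewrite distrC.
have [U [Ux Uphi]] := filter_ex (filterI unif (Mnear _ _ (Mcont (fun y x => E x y) cE') e2)).
have : `|M (fun x => A U (E x)) - M (fun x => M (E x))| <= e / 2.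
  apply: Mdist => //; last exact: Mcont.
  by apply: cfZ; apply: cf_sum => y; exact: (@cf_pairl _ _ _ (fun y x => E x y) y cE').
rewrite Mavg//; move: Uphi; rewrite -/(A U _) !ler_norml.
by move=> /andP[? ?] /andP[? ?]; apply/andP; split; lra.
Qed.

End HaarMean.

(** * Inequalities and faithfulness of the mean *)

Section MeanTheory.
Variables (R : realType) (G : topologicalGroupType).
Hypothesis compactG : compact [set: G].
Local Open Scope ring_scope.
Import Order.TTheory GRing.Theory Num.Theory numFieldNormedType.Exports.
Implicit Types (f g : G -> R).
Variable M : (G -> R) -> R.
Hypothesis haarM : haar_mean M.

Lemma meanZ c f : continuous f -> M (fun x => c * f x) = c * M f.
Proof.
move=> cf; rewrite -[RHS]addr0 -[X in _ = _ + X](mean_cst haarM 0).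
rewrite -(mean_lin haarM)//; last exact: cfC.
by congr (M _); apply/funext => x; rewrite addr0.
Qed.

Lemma meanD f g : continuous f -> continuous g ->
  M (fun x => f x + g x) = M f + M g.
Proof.
move=> cf cg; rewrite -[X in _ = X + _]mul1r -(mean_lin haarM)//.
by congr (M _); apply/funext => x; rewrite mul1r.
Qed.

Lemma meanB f g : continuous f -> continuous g ->
  M (fun x => f x - g x) = M f - M g.
Proof.
move=> cf cg; rewrite addrC -[X in _ = X + _]mulN1r -(mean_lin haarM)//.
by congr (M _); apply/funext => x; rewrite mulN1r addrC.
Qed.

Lemma mean_ge0 f : continuous f -> (forall x, 0 <= f x) -> 0 <= M f.
Proof.
by move=> cf f0; rewrite -(mean_cst haarM 0); apply: (mean_le haarM) => //; exact: cfC.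
Qed.

Lemma mean_norm f (c : R) : continuous f -> (forall x, `|f x| <= c) -> `|M f| <= c.
Proof.
move=> cf fc; rewrite ler_norml -[- c](mean_cst haarM) -[X in _ && (_ <= X)](mean_cst haarM).
by apply/andP; split; apply: (mean_le haarM) => //; try exact: cfC; move=> x;
  have := fc x; rewrite ler_norml => /andP[].
Qed.

Lemma mean_dist f g (e : R) : continuous f -> continuous g ->
  (forall x, `|f x - g x| <= e) -> `|M f - M g| <= e.
Proof. by move=> cf cg fg; rewrite -meanB//; apply: mean_norm => //; exact: cfB. Qed.

(** The difference of the two sides is the variance, the mean of the square of f - M f. *)
Lemma mean_sqr f : continuous f -> M f ^+ 2 <= M (fun x => f x * f x).
Proof.
move=> cf; set m := M f.
have cff : continuous (fun x => f x * f x) by exact: cfM.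
have cg : continuous (fun x => (f x - m) * (f x - m)).
  by apply: cfM; apply: cfB => //; exact: cfC.
have := mean_ge0 cg (fun x => sqr_ge0 (f x - m)).
have -> : (fun x => (f x - m) * (f x - m)) =
    (fun x => (- (2 * m)) * f x + (f x * f x + (fun=> m ^+ 2) x)).
  by apply/funext => x; ring.
rewrite (mean_lin haarM)//; last by apply: cfD => //; exact: cfC.
rewrite meanD//; last exact: cfC.
by rewrite (mean_cst haarM) -/m => ?; lra.
Qed.

Lemma mean_continuous (K : G -> G -> R) :
  continuous (fun z : G * G => K z.1 z.2) -> continuous (fun x => M (K x)).
Proof.
move=> cK x; apply/cvgrPdist_le => e e0.
apply: filterS (cf_tube compactG cK x e0) => y Hy; rewrite distrC.
by apply: mean_dist => //; exact: cf_pairl.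
Qed.

Lemma cf_closed_le f (c : R) : continuous f -> closed [set x | f x <= c].
Proof.
move=> cf; apply: (@preimage_closed _ _ f [set x | x <= c]) => [x _|].
  exact: cf.
exact: closed_le.
Qed.

Lemma cf_pos_bound f : continuous f -> (forall x, 0 < f x) ->
  exists2 e : R, 0 < e & forall x, e <= f x.
Proof.
move=> cf f0; have [|||x _ fx] := @compact_EVT_min G R f setT.
- by exists 1%g.
- exact: compactG.
- exact: continuous_subspaceT.
- by exists (f x) => // y; apply: fx; exact: in_setT.
Qed.

(* If M f = 0, then the nonnegative functions of mean 0 have no common zero, so
   by compactness one of them is positive everywhere. *)
Lemma mean_gt0 f x0 : continuous f -> (forall x, 0 <= f x) -> 0 < f x0 -> 0 < M f.
Proof.
move=> cf f0 fx0; rewrite lt0r mean_ge0// andbT; apply/eqP => Mf0.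
pose D := [set g : G -> R | [/\ continuous g, forall x, 0 <= g x & M g = 0]].
pose Z g := [set x | g x <= 0].
have [||||_ [g [cg g0 Mg0] <-] Zg] :=
    @compact_directed G compactG [set Z g | g in D] set0 _ _ _ open0.
- by exists (Z f), f.
- move=> _ _ [g [cg g0 Mg] <-] [h [ch h0 Mh] <-].
  exists (Z (fun x => g x + h x)).
    exists (fun x => g x + h x) => //; split; [exact: cfD|by move=> x; rewrite addr_ge0|].
    by rewrite meanD// Mg Mh addr0.
  by move=> x; rewrite /Z /= => gh; have := g0 x; have := h0 x; split; lra.
- by move=> _ [g [cg _ _] <-]; exact: cf_closed_le.
(* The translate of [f] that takes the value [f x0] at x also has mean 0, so x is not a common
   zero. *)
- move=> x /(_ (Z (fun y => f (x0 * x^-1 * y)%g))) Zx.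
  have : Z (fun y => f (x0 * x^-1 * y)%g) x.
    apply: Zx; exists (fun y => f (x0 * x^-1 * y)%g) => //; split.
    - by apply: cf_comp => //; exact: mulgl_continuous.
    - by move=> y; exact: f0.
    - by rewrite (mean_inv haarM).
  by rewrite /Z /= mulgVK leNgt fx0.
- have [|e e0 ge] := cf_pos_bound cg.
    by move=> x; rewrite ltNge; apply/negP => gx; exact: (Zg x).
  have := mean_le haarM (@cfC R G e) cg ge; rewrite Mg0 (mean_cst haarM).
  by rewrite leNgt e0.
Qed.

Lemma mean_sqr_eq0 f : continuous f -> M (fun x => f x * f x) = 0 -> forall x, f x = 0.
Proof.
move=> cf M0 x; apply/eqP; apply: contraT => fx0.
have := @mean_gt0 (fun x => f x * f x) x (cfM cf cf) (fun x => sqr_ge0 (f x)).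
by rewrite M0 ltxx; apply; rewrite -expr2 exprn_even_gt0.
Qed.

End MeanTheory.

(** * Convolution operators *)

Section ConvolutionOperator.
Variables (R : realType) (G : topologicalGroupType).
Hypothesis compactG : compact [set: G].
Local Open Scope ring_scope.
Import Order.TTheory GRing.Theory Num.Theory numFieldNormedType.Exports.
Implicit Types (f g : G -> R).
Variable M : (G -> R) -> R.
Hypothesis haarM : haar_mean M.
Variable k : G -> R.
Hypothesis k_continuous : continuous k.
Hypothesis k_sym : forall z, k z^-1%g = k z.

(** Depending on x^-1 y only, the kernel yields an operator that commutes with left translations;
    [k_sym] makes it symmetric. *)
Let ker (x y : G) := k (x^-1 * y)%g.

Definition conv f x := M (fun y => ker x y * f y).

Let ker_continuous : continuous (fun z : G * G => ker z.1 z.2).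
Proof.
apply: cf_comp => //; apply: mulg_fun_continuous => z; last exact: cvg_snd.
by apply: cvg_invg; exact: cvg_fst.
Qed.

Let ker_continuousr x : continuous (ker x).
Proof. exact: cf_pairl. Qed.

Let ker_sym x y : ker x y = ker y x.
Proof. by rewrite /ker -k_sym invgM invgK. Qed.

Let kerf_continuous f : continuous f ->
  continuous (fun z : G * G => ker z.1 z.2 * f z.2).
Proof.
by move=> cf; apply: cfM => //; apply: cf_comp => // z; exact: cvg_snd.
Qed.

Lemma conv_continuous f : continuous f -> continuous (conv f).
Proof.
move=> cf; apply: (@mean_continuous _ _ compactG _ haarM (fun x y => ker x y * f y)).
exact: kerf_continuous.
Qed.

Lemma conv_lin a f g : continuous f -> continuous g ->
  conv (fun x => a * f x + g x) = (fun x => a * conv f x + conv g x).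
Proof.
move=> cf cg; apply/funext => x.
rewrite /conv -(mean_lin haarM); [|exact: cfM|exact: cfM].
by congr (M _); apply/funext => y; ring.
Qed.

Lemma conv_sym f g : continuous f -> continuous g ->
  M (fun x => conv f x * g x) = M (fun x => f x * conv g x).
Proof.
move=> cf cg.
have -> : (fun x => conv f x * g x) = (fun x => M (fun y => g x * (ker x y * f y))).
  by apply/funext => x; rewrite (meanZ haarM) ?[_ * g x]mulrC//; exact: cfM.
rewrite (mean_fubini haarM (F := fun x y => g x * (ker x y * f y))); last first.
  apply: cfM; last exact: kerf_continuous.
  by apply: cf_comp => // z; exact: cvg_fst.
congr (M _); apply/funext => y; rewrite -(meanZ haarM); last exact: cfM.
by congr (M _); apply/funext => x; rewrite ker_sym; ring.
Qed.

Lemma conv_mull (h : G) f x : continuous f ->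
  conv (fun y => f (h^-1 * y)%g) x = conv f (h^-1 * x)%g.
Proof.
move=> cf; rewrite /conv -[LHS](mean_inv haarM h); last first.
  by apply: cfM => //; apply: cf_comp => //; exact: mulgl_continuous.
by congr (M _); apply/funext => y; rewrite mulKg /ker invgM invgK !mulgA.
Qed.

Let ker_bounded : exists2 c : R, 0 < c & forall x y, `|ker x y| <= c.
Proof. by have [c c0 kc] := cf_bounded compactG k_continuous; exists c => // x y; exact: kc. Qed.

Lemma conv_bounded : exists2 c : R, 0 < c & forall f, continuous f ->
  (forall d x, (forall y, `|f y| <= d) -> `|conv f x| <= c * d) /\
  (forall x, conv f x ^+ 2 <= c ^+ 2 * M (fun y => f y * f y)).
Proof.
have [c c0 kc] := ker_bounded; exists c => // f cf; split=> [d x fd|x].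
  apply: (mean_norm haarM) => [|y]; first exact: cfM.
  by rewrite normrM ler_pM.
have ckf : continuous (fun y => ker x y * f y) by exact: cfM.
apply: le_trans (mean_sqr haarM ckf) _.
rewrite -(meanZ haarM); last exact: cfM.
apply: (mean_le haarM) => [||y]; [exact: cfM|by apply: cfZ; exact: cfM|].
rewrite mulrACA -!expr2 ler_wpM2r ?sqr_ge0//.
by rewrite -[leLHS]real_normK ?num_real// ler_sqr ?nnegrE// ltW.
Qed.

(** By Cauchy-Schwarz, from the uniform continuity of the kernel. This takes the place of
    compactness of the operator on L2. *)
Lemma conv_equi : equi [set conv f | f in
  [set f : G -> R | continuous f /\ M (fun y => f y * f y) <= 1]].
Proof.
move=> x e e0; apply: filterS (cf_tube compactG ker_continuous x e0) => y Hy _ [f [cf f1] <-].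
rewrite -ler_sqr ?nnegrE ?(ltW e0)// real_normK ?num_real//.
have -> : conv f y - conv f x = M (fun z => (ker y z - ker x z) * f z).
  rewrite /conv -(meanB haarM); [|exact: cfM|exact: cfM].
  by congr (M _); apply/funext => z; rewrite mulrBl.
have cd : continuous (fun z => ker y z - ker x z) by exact: cfB.
have cdf : continuous (fun z => (ker y z - ker x z) * f z) by exact: cfM.
apply: le_trans (mean_sqr haarM cdf) _.
apply: (@le_trans _ _ (e ^+ 2 * M (fun y => f y * f y))); last first.
  by rewrite ler_piMr ?sqr_ge0.
rewrite -(meanZ haarM); last exact: cfM.
apply: (mean_le haarM) => [||z]; [exact: cfM|by apply: cfZ; exact: cfM|].
rewrite mulrACA -!expr2 ler_wpM2r ?sqr_ge0//.
by rewrite -[leLHS]real_normK ?num_real// ler_sqr ?nnegrE ?(ltW e0)//; exact: Hy.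
Qed.

(** The eigenspace of the square of the operator: it contains the eigenvectors for both square roots
    of [l]. *)
Definition conv_eigen (l : R) : set (G -> R) :=
  [set e : G -> R | continuous e /\ forall x, conv (conv e) x = l * e x].

(* The spectral theorem for the compact symmetric operator conv: maximizing
   M (conv f)^2 on the unit ball of the orthogonal of the eigenspaces of conv^2
   would produce a further eigenvector. *)
Lemma conv_orthogonal f : continuous f ->
  (forall l e, 0 < l -> conv_eigen l e -> M (fun x => f x * e x) = 0) ->
  forall x, conv f x = 0.
Proof.
pose X g := continuous g /\
  forall l e, 0 < l -> conv_eigen l e -> M (fun x => g x * e x) = 0.
move=> cf oX; have {cf oX}Xf : X f by [].
have [c c0 cb] := conv_bounded.
(* [conv] is symmetric and preserves each eigenspace of its square, hence also their orthogonal. *)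
have XT g : X g -> X (conv g).
  move=> [cg og]; split=> [|l e l0 El]; first exact: conv_continuous.
  have [ce eE] := El; rewrite conv_sym//; apply: og l0 _.
  split=> [|x]; first exact: conv_continuous.
  have := conv_lin l ce (@cfC R G 0).
  have -> : (fun x => l * e x + 0) = conv (conv e).
    by apply/funext => y; rewrite addr0 eE.
  move=> ->; rewrite -[RHS]addr0; congr (_ + _).
  by rewrite /conv -[RHS](mean_cst haarM); congr (M _); apply/funext => y; rewrite mulr0.
pose Q g := M (fun x => g x * g x).
have Q0 g : continuous g -> 0 <= Q g.
  by move=> cg; apply: (mean_ge0 haarM) => [|x]; [exact: cfM|exact: sqr_ge0].
have QZ a g : continuous g -> Q (fun x => a * g x) = a ^+ 2 * Q g.
  move=> cg; rewrite /Q -(meanZ haarM); last exact: cfM.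
  by congr (M _); apply/funext => x; ring.
have QT g : continuous g -> Q (conv g) <= c ^+ 2 * Q g.
  move=> cg; have [_ cg2] := cb g cg.
  rewrite -(mean_cst haarM (c ^+ 2 * Q g)); apply: (mean_le haarM).
  - by apply: cfM; exact: conv_continuous.
  - exact: cfC.
  - by move=> x; rewrite -expr2; exact: cg2.
have XZ a g : X g -> X (fun x => a * g x).
  move=> [cg og]; split=> [|l e l0 El]; first exact: cfZ.
  have -> : (fun x => a * g x * e x) = (fun x => a * (g x * e x)).
    by apply/funext => x; rewrite mulrA.
  by rewrite (meanZ haarM) ?(og l)// ?mulr0//; apply: cfM => //; case: El.
have TZ a g : continuous g -> conv (fun x => a * g x) = (fun x => a * conv g x).
  move=> cg; apply/funext => x; rewrite /conv -(meanZ haarM); last exact: cfM.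
  by congr (M _); apply/funext => y; ring.
pose S := [set Q (conv g) | g in [set g | X g /\ Q g <= 1]].
have hS : has_sup S.
  split.
    exists (Q (conv (fun x => 0 * f x))), (fun x => 0 * f x) => //.
    by split; [exact: XZ|rewrite QZ ?expr0n ?mul0r//; case: Xf].
  exists (c ^+ 2) => _ [g [[cg _] g1] <-]; apply: le_trans (QT g cg) _.
  by rewrite ler_piMr ?sqr_ge0.
pose m := sup S.
have Qm g : X g -> Q (conv g) <= m * Q g.
  move=> Xg; have cg := Xg.1.
  have := Q0 g cg; rewrite le_eqVlt => /predU1P[Qg|Qg].
    by rewrite -Qg mulr0; have := QT g cg; rewrite -Qg mulr0.
  pose a := (Num.sqrt (Q g))^-1.
  have a2 : a ^+ 2 = (Q g)^-1 by rewrite exprVn sqr_sqrtr// ltW.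
  rewrite -ler_pdivrMr// mulrC -a2 -QZ; last exact: conv_continuous.
  rewrite -TZ//; apply: ub_le_sup; first by case: hS.
  exists (fun x => a * g x) => //; split; first exact: XZ.
  by rewrite QZ// a2 mulVf// gt_eqF.
move=> x0; apply/eqP; apply: contraT => Tf0.
have cTf : continuous (conv f) by apply: conv_continuous; case: Xf.
have QTf : 0 < Q (conv f).
  apply: (@mean_gt0 _ _ compactG _ haarM _ x0); [exact: cfM|by move=> x; exact: sqr_ge0|].
  by rewrite -expr2 exprn_even_gt0.
have m0 : 0 < m.
  have := lt_le_trans QTf (Qm f Xf); rewrite pmulr_lgt0// lt0r Q0 ?andbT; last by case: Xf.
  by apply: contraTneq QTf => Qf; have := QT f Xf.1; rewrite Qf mulr0 leNgt.
(* The functions that nearly attain the supremum [m]. Along an ultrafilter of such g, the images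
   [conv g] converge uniformly to some [u], the candidate eigenvector. *)
pose J := filter_from [set e : R | 0 < e]
  (fun e => [set g | [/\ X g, Q g <= 1 & m - e < Q (conv g)]]).
have PJ : ProperFilter J.
  apply: filter_from_proper.
    apply: filter_from_filter; first by exists 1 => /=.
    move=> a b /= a0 b0; exists (Num.min a b); first by rewrite /= lt_min a0.
    move=> g [Xg g1 gm]; have := ge_min a a b; have := ge_min b a b.
    by rewrite !lexx orbT /= => ? ?; split; split=> //; lra.
  move=> e /= e0; have [_ [g [Xg g1] <-] ge] := sup_adherent e0 hS.
  by exists g.
have [F [ultraF JF]] := ultraFilterLemma PJ.
have near_max (e : R) : 0 < e ->
    \forall g \near F, [/\ X g, Q g <= 1 & m - e < Q (conv g)].
  by move=> e0; apply: JF; exists e.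
have [||u cu near_u] := @ultra_equicontinuous R _ F ultraF G compactG _ conv c conv_equi.
- by apply: filterS (near_max 1 ltr01) => g [[cg _] g1 _]; exists g.
- apply: filterS (near_max 1 ltr01) => g [[cg _] g1 _] x.
  have [_ /(_ x) cgx] := cb g cg.
  rewrite -ler_sqr ?nnegrE ?(ltW c0)// real_normK ?num_real//.
  by apply: le_trans cgx _; rewrite ler_piMr ?sqr_ge0.
have Xu : X u.
  split=> // l e l0 El; have ce := El.1.
  have [b b0 eb] := cf_bounded compactG ce.
  apply/eqP; rewrite -normr_le0; apply/ler_addgt0Pr => d d0; rewrite add0r.
  have db : 0 < d / b by rewrite divr_gt0.
  have [g [[Xg _ _] ug]] := filter_ex (filterI (near_max 1 ltr01) (near_u _ db)).
  have [cg og] := XT g Xg.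
  rewrite -[M _]subr0 -(og l e l0 El); apply: (mean_dist haarM) => [||x]; try exact: cfM.
  rewrite -mulrBl normrM -[d](divfK (lt0r_neq0 b0)) ler_pM//.
  by rewrite distrC; exact: ug.
have Eu : conv_eigen m u.
  split=> // x; apply/eqP; rewrite -subr_eq0 -normr_le0.
  apply/ler_addgt0Pr => d d0; rewrite add0r.
  (* [K] collects the factors of [e] in the bounds of [conv (conv w)], [conv v] and [m * w], whose
     combination is the quantity to estimate. *)
  pose K := c * c + 1 + m; have K0 : 0 < K by rewrite !addr_gt0 ?mulr_gt0.
  pose e := d / K; have e0 : 0 < e by rewrite divr_gt0.
  have e'0 : 0 < e ^+ 2 / (c ^+ 2 * m).
    by apply: divr_gt0; [exact: exprn_gt0|apply: mulr_gt0 => //; exact: exprn_gt0].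
  have [g [[Xg g1 gm] ug]] := filter_ex (filterI (near_max _ e'0) (near_u _ e0)).
  have cg := Xg.1; have ccg := conv_continuous cg; have cccg := conv_continuous ccg.
  pose w y := -1 * conv g y + u y.
  have cw : continuous w by apply: cfD => //; exact: cfZ.
  have we y : `|w y| <= e by rewrite /w mulN1r addrC distrC; exact: ug.
  have cwe y : `|conv w y| <= c * e by have [cb1 _] := cb w cw; exact: cb1.
  have ccwe : `|conv (conv w) x| <= c * (c * e).
    by have [cb1 _] := cb _ (conv_continuous cw); exact: cb1.
  (* The defect of [g] as an eigenvector. Expanding the square gives Q v <= m (m - Q (conv g)),
     which is small for a near-maximizer; [conv] then makes [v] uniformly small. *)
  pose v y := - m * g y + conv (conv g) y.
  have cv : continuous v by apply: cfD => //; exact: cfZ.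
  have gcc : M (fun y => g y * conv (conv g) y) = Q (conv g) by rewrite -conv_sym.
  have Qv : Q v <= e ^+ 2 / c ^+ 2.
    have -> : Q v = m ^+ 2 * Q g + (- (2 * m) * Q (conv g) + Q (conv (conv g))).
      have cgcc : continuous (fun y => g y * conv (conv g) y) by exact: cfM.
      have c4 : continuous (fun y => conv (conv g) y * conv (conv g) y) by exact: cfM.
      rewrite -gcc -(mean_lin haarM _ cgcc c4) -(mean_lin haarM).
      - by congr (M _); apply/funext => y; rewrite /v; ring.
      - exact: cfM.
      - by apply: cfD => //; exact: cfZ.
    have := Qm _ (XT g Xg).
    have : m ^+ 2 * Q g <= m ^+ 2 by rewrite ler_piMr ?sqr_ge0.
    have -> : e ^+ 2 / c ^+ 2 = m * (e ^+ 2 / (c ^+ 2 * m)).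
      by field; rewrite !gt_eqF.
    by move: gm => /ltW; rewrite lerBlDr -(ler_pM2l m0) mulrDr; lra.
  have cve : `|conv v x| <= e.
    have [_ /(_ x) cb2] := cb v cv.
    rewrite -ler_sqr ?nnegrE ?(ltW e0)// real_normK ?num_real//.
    apply: le_trans cb2 _; rewrite mulrC -ler_pdivlMr ?exprn_gt0//.
  have -> : conv (conv u) x - m * u x =
      conv (conv w) x + conv v x - m * w x.
    rewrite /w /v !conv_lin//; try exact: conv_continuous.
    by ring.
  have -> : d = c * (c * e) + e + m * e by rewrite /e /K; field; rewrite gt_eqF.
  apply: le_trans (ler_normB _ _) _; apply: lerD.
    by apply: le_trans (ler_normD _ _) _; exact: lerD.
  by rewrite normrM (gtr0_norm m0) ler_pM2l.
(* As an eigenvector orthogonal to all eigenvectors, [u] vanishes. But [conv g] is close to [u]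
   while [Q (conv g)] exceeds [m / 2]. *)
have u0 := mean_sqr_eq0 compactG haarM cu (Xu.2 m u m0 Eu).
pose e := Num.min 1 (m / 4).
have e0 : 0 < e by rewrite lt_min ltr01 divr_gt0.
have m2 : 0 < m / 2 by rewrite divr_gt0.
have [g [[Xg _ gm] ug]] := filter_ex (filterI (near_max _ m2) (near_u _ e0)).
have : Q (conv g) <= e.
  rewrite -(mean_cst haarM e); apply: (mean_le haarM) => [||x].
  - by apply: cfM; apply: conv_continuous; case: Xg.
  - exact: cfC.
  - have := ug x; rewrite u0 subr0 => uge.
    have e1 : e <= 1 by rewrite ge_min lexx.
    rewrite -expr2 -real_normK ?num_real//; apply: le_trans (_ : e ^+ 2 <= e).
      by rewrite ler_sqr ?nnegrE// ltW.
    by rewrite expr2 ler_piMr// ltW.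
have : e <= m / 4 by rewrite ge_min lexx orbT.
lra.
Qed.

End ConvolutionOperator.

(** * Groups acting on functions by translation *)

Section TranslationKernel.
Variables (R : realType) (G : topologicalGroupType).
Hypothesis hausdorffG : hausdorff_space G.
Hypothesis compactG : compact [set: G].
Local Open Scope ring_scope.
Import Order.TTheory GRing.Theory Num.Theory numFieldNormedType.Exports.
Implicit Types (e f : G -> R) (g h : G).

Definition act h e : G -> R := fun x => e (h^-1 * x)%g.

Lemma act1 e : act 1%g e = e.
Proof. by apply/funext => x; rewrite /act invg1 mul1g. Qed.

Lemma actM g h e : act (g * h)%g e = act g (act h e).
Proof. by apply/funext => x; rewrite /act invgM mulgA. Qed.

Variable E : set (G -> R).
Hypothesis E_continuous : forall e, E e -> continuous e.
Hypothesis E0 : E (fun=> 0).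
Hypothesis E_lin : forall a e f, E e -> E f -> E (fun x => a * e x + f x).
Hypothesis E_act : forall h e, E e -> E (act h e).

Definition unit_ball : set (G -> R) := [set e | E e /\ forall x, `|e x| <= 1].
Local Notation B := unit_ball.

Hypothesis E_equi : equi B.

Definition act_kernel : set G := [set h | forall e, E e -> act h e = e].

(** The operator norm of [act h] - 1 on [E] for the uniform norm, a continuous measure of the
    distance from h to the kernel of the action. Equicontinuity of the unit ball stands in for
    finite dimension of [E]. *)
Definition act_norm h : R :=
  sup [set r | exists e x, B e /\ r = `|act h e x - e x|].
Local Notation s := act_norm.

Let EZ a e : E e -> E (fun x => a * e x).
Proof.
move=> Ee; have := E_lin a Ee E0; congr E; apply/funext => x; exact: addr0.
Qed.

Let EB e f : E e -> E f -> E (fun x => e x - f x).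
Proof.
move=> Ee Ef; have := E_lin (-1) Ef Ee; congr E; apply/funext => x.
by rewrite mulN1r addrC.
Qed.

Let B_act h e : B e -> B (act h e).
Proof. by move=> [Ee e1]; split=> [|x]; [exact: E_act|exact: e1]. Qed.

Let s_has_sup h : has_sup [set r | exists e x, B e /\ r = `|act h e x - e x|].
Proof.
split.
  exists `|act h (fun=> 0) 1%g - 0|, (fun=> 0), 1%g; split=> //.
  by split=> // x; rewrite normr0.
exists 2 => _ [e [x [[_ e1] ->]]]; apply: le_trans (ler_normB _ _) _.
by rewrite (_ : 2 = 1 + 1)// lerD// e1.
Qed.

Lemma act_norm_ub h e x : B e -> `|act h e x - e x| <= s h.
Proof. by move=> Be; apply: ub_le_sup; [case: (s_has_sup h)|exists e, x]. Qed.

Lemma act_norm_le h (c : R) :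
  (forall e x, B e -> `|act h e x - e x| <= c) -> s h <= c.
Proof.
move=> hc; apply: ge_sup; first by case: (s_has_sup h).
by move=> _ [e [x [Be ->]]]; exact: hc.
Qed.

Lemma act_norm_ge0 h : 0 <= s h.
Proof.
have B0 : B (fun=> 0) by split=> // x; rewrite normr0.
by apply: le_trans (act_norm_ub h 1%g B0); exact: normr_ge0.
Qed.

Lemma act_norm_hom h e (c : R) x : E e -> (forall y, `|e y| <= c) ->
  `|act h e x - e x| <= s h * c.
Proof.
move=> Ee ec; have := le_trans (normr_ge0 _) (ec 1%g).
rewrite le_eqVlt => /predU1P[c0|c0].
  have e0 y : e y = 0 by apply/eqP; rewrite -normr_le0 c0.
  by rewrite /act !e0 subrr normr0 -c0 mulr0.
have cV0 : 0 <= c^-1 by rewrite invr_ge0 ltW.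
have Be : B (fun y => c^-1 * e y).
  split=> [|y]; first exact: EZ.
  by rewrite normrM ger0_norm// ler_pdivrMl// mulr1.
have := act_norm_ub h x Be.
by rewrite /act -mulrBr normrM ger0_norm// ler_pdivrMl// mulrC.
Qed.

Lemma act_normM g h : s (g * h)%g <= s g + s h.
Proof.
apply: act_norm_le => e x Be; rewrite actM.
rewrite (_ : _ - _ = (act h e (g^-1 * x)%g - e (g^-1 * x)%g) + (act g e x - e x)); last first.
  by rewrite /act; ring.
by apply: le_trans (ler_normD _ _) _; rewrite addrC lerD// act_norm_ub.
Qed.

Lemma act_normV h : s h^-1%g = s h.
Proof.
have sV k : s k^-1%g <= s k.
  apply: act_norm_le => e x Be; have := act_norm_ub k (k * x)%g Be.
  by rewrite /act invgK mulKg distrC.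
by apply/eqP; rewrite eq_le sV -[X in s X <= _]invgK sV.
Qed.

Lemma act_norm_near1 (c : R) : 0 < c -> \forall h \near (1%g : G), s h <= c.
Proof.
move=> c0; have c2 : 0 < c / 2 by rewrite divr_gt0.
have /compact_near_coveringP := compactG.
move=> /(_ G (nbhs (1%g : G)) (fun h x => forall e, B e -> `|act h e x - e x| <= c) _) cov.
apply: filterS (cov _) => [h H|x _].
  by apply: act_norm_le => e x Be; exact: H.
have nx := E_equi x c2.
have : nbhs (x, 1%g : G) [set z : G * G |
    forall e, B e -> `|e (z.2^-1 * z.1)%g - e x| <= c / 2].
  have cF : continuous (fun z : G * G => z.2^-1 * z.1)%g.
    apply: mulg_fun_continuous => z; last exact: cvg_fst.
    by apply: cvg_invg; exact: cvg_snd.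
  by have := cF (x, 1%g); rewrite /continuous_at /= invg1 mul1g => /(_ _ nx).
case=> -[N1 N2] /= [n1 n2] N12; exists (N1 `&` [set y | forall e, B e -> `|e y - e x| <= c / 2], N2).
  by split => //; exact: filterI.
move=> [y h] /= [[N1y ey] N2h] e Be.
have := N12 (y, h) (conj N1y N2h) e Be; have := ey e Be; rewrite /act /= !ler_norml.
by move=> /andP[? ?] /andP[? ?]; apply/andP; split; lra.
Qed.

Lemma act_norm_continuous : continuous s.
Proof.
move=> h; apply/cvgrPdist_le => c c0.
have : \forall k \near h, s (h^-1 * k)%g <= c.
  by apply/nbhs_mulgl; under eq_fun do rewrite /= mulKg; exact: act_norm_near1.
apply: filterS => k hk; rewrite ler_norml.
have := act_normM h (h^-1 * k)%g; rewrite mulVKg.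
have := act_normM k (h^-1 * k)^-1%g; rewrite act_normV invgM invgK mulVKg.
by move=> ? ?; apply/andP; split; lra.
Qed.

Lemma act_kernelE : act_kernel = [set h | s h <= 0].
Proof.
apply/seteqP; split=> h.
  by move=> hk; apply: act_norm_le => e x [Ee _]; rewrite hk// subrr normr0.
move=> h0 e Ee; apply/funext => x; apply/eqP; rewrite -subr_eq0 -normr_le0.
have [c c0 ec] := cf_bounded compactG (E_continuous Ee).
by apply: le_trans (act_norm_hom h x Ee ec) _; rewrite pmulr_lle0.
Qed.

Lemma act_normX h k e (c : R) x : E e -> (forall y, `|e y| <= c) ->
  `|act (h ^+ k)%g e x - e x| <= k%:R * s h * c.
Proof.
move=> Ee ec; elim: k x => [|k IH] x.
  by rewrite expg0 act1 subrr normr0 !mul0r.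
rewrite expgSr actM.
set y := ((h ^+ k)^-1 * x)%g.
rewrite (_ : _ - _ = (act h e y - e y) + (act (h ^+ k)%g e x - e x)); last first.
  by rewrite /act /y; ring.
apply: le_trans (ler_normD _ _) _; apply: le_trans (lerD (act_norm_hom h y Ee ec) (IH x)) _.
by rewrite -natr1; lra.
Qed.

(** In operator notation, h^k - 1 - k (h - 1) is the sum over j < k of (h^j - 1)(h - 1), whose terms
    have norm at most j [s h]^2. *)
Lemma act_normX2 h k e x : B e ->
  `|act (h ^+ k)%g e x - e x - k%:R * (act h e x - e x)| <= (k%:R * s h) ^+ 2.
Proof.
move=> Be; have Ee := Be.1.
have Ef : E (fun x => act h e x - e x) by apply: EB => //; exact: E_act.
elim: k => [|k IH].
  by rewrite expg0 act1 subrr !mul0r subr0 normr0 expr0n.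
rewrite expgSr actM.
set f := fun x => act h e x - e x in Ef *.
rewrite (_ : _ - _ - _ = (act (h ^+ k)%g f x - f x) +
  (act (h ^+ k)%g e x - e x - k%:R * (act h e x - e x))); last first.
  by rewrite -natr1 /f /act; ring.
have fs y : `|f y| <= s h by exact: act_norm_ub.
apply: le_trans (ler_normD _ _) _.
apply: le_trans (lerD (act_normX h k x Ef fs) IH) _.
rewrite -natr1; have := act_norm_ge0 h; have : (0 : R) <= k%:R by [].
by move=> ? ?; nra.
Qed.


Let act_kernel_subgroup : is_subgroup act_kernel.
Proof.
split=> [e _|g h kg kh e Ee]; first exact: act1.
rewrite actM (_ : act h^-1%g e = e) ?kg//.
by rewrite -{1}(kh e Ee) -actM mulVg act1.
Qed.

Let act_kernel_normal : is_normal act_kernel.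
Proof.
move=> h g kh e Ee; rewrite !actM (kh _ (E_act g Ee)) -actM mulVg.
exact: act1.
Qed.

Let act_kernel_closed : closed act_kernel.
Proof. by rewrite act_kernelE; apply: cf_closed_le; exact: act_norm_continuous. Qed.

(* If h_n in H_n \ H, H the intersection, is chosen closest to 1 in its coset
   h_n H, then h_n - 1 and h_m - 1 point in almost the same direction, for n and m
   large along an ultrafilter, by compactness of the unit ball of E. Hence h_n is
   much closer to the power of h_m of the right length than to 1, and so to a
   limit of such powers, which lies in H. *)
Lemma act_kernel_noetherian : noetherian act_kernel.
Proof.
split=> // H sH cH kH dH.
pose K := \bigcap_(n in setT) H n.
have sK : is_subgroup K by apply: subgroup_bigcap.
have cK : closed K by apply: closed_bigI.
suff [n0 HK] : exists n, H n `<=` K.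
  by exists n0 => n _ g /HK; exact.
apply: contrapT => nHK.
have /boolp.choice[h hP] : forall n, exists h,
    [/\ H n h, ~ K h & forall g, K g -> s h <= s (h * g)%g].
  move=> n; have [h [Hh nKh]] : exists h, H n h /\ ~ K h.
    apply: contrapT => nex; apply: nHK; exists n => h Hh.
    by apply: contrapT => nKh; apply: nex; exists h.
  have [|||g /set_mem Kg gmin] := @compact_EVT_min G R (fun g => s (h * g)%g) K.
  - by exists 1%g; exact: sK.1.
  - exact: closed_is_compact.
  - apply: continuous_subspaceT; apply: cf_comp; first exact: act_norm_continuous.
    exact: mulgl_continuous.
  exists (h * g)%g; split.
  - by apply: subgroupM => //; exact: Kg.
  - move=> Khg; apply: nKh; have := subgroupM sK Khg (subgroupV sK Kg).
    by rewrite mulgK.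
  - move=> k Kk; rewrite -mulgA; apply: gmin; apply/mem_set.
    exact: (subgroupM sK).
have [F [ultraF nF]] := @ultraFilterLemma nat \oo _.
pose a n := s (h n).
have a0 n : 0 < a n.
  have [_ nKh _] := hP n; rewrite ltNge; apply/negP => an; apply: nKh => m _.
  by apply: kH; rewrite act_kernelE.
have limK (p : nat -> G) : (forall n, H n (p n)) -> exists2 g, K g & p @ F --> g.
  move=> Hp; have Fp : \forall n \near F, [set: G] (p n) by apply: nearW.
  have [g _ pg] := ultra_cvg_compact ultraF compactG Fp.
  exists g => // m _; apply: cH => V nV.
  have Fm : \forall n \near F, H m (p n).
    by apply: nF; exists m => // n /= mn; apply: (chain_sub dH mn).
  by have [n [Hn Vn]] := filter_ex (filterI Fm (pg V nV)); exists (p n).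
have near1 (p : nat -> G) g (c : R) : 0 < c -> p @ F --> g ->
    \forall n \near F, s (p n * g^-1)%g <= c.
  move=> c0 pg; have : (fun n => p n * g^-1)%g @ F --> (1 : G)%g.
    by rewrite -(mulgV g); apply: cvg_mulg => //; exact: cvg_cst.
  by move/(_ _ (act_norm_near1 c0)).
(* [h n] approaches some g of [K], so h_n g^-1 tends to 1; minimality in the coset bounds [a n] by
   the norm of that product. *)
have a_small (c : R) : 0 < c -> \forall n \near F, a n <= c.
  move=> c0; have [|g Kg hg] := limK h; first by move=> n; have [] := hP n.
  apply: filterS (near1 h g c c0 hg) => n; apply: le_trans.
  by have [_ _] := hP n; apply; exact: (subgroupV sK).
pose D n e x := (act (h n) e x - e x) / a n.
have DE n e x : act (h n) e x - e x = a n * D n e x.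
  by rewrite /D mulrC divfK// gt_eqF.
have D_hom n e (c : R) x : E e -> (forall y, `|e y| <= c) -> `|D n e x| <= c.
  move=> Ee ec; rewrite /D normrM [`|_^-1|]ger0_norm ?invr_ge0 ?(ltW (a0 n))//.
  by rewrite ler_pdivrMr// mulrC; exact: act_norm_hom.
have D_ball n e : B e -> B (D n e).
  move=> [Ee e1]; split=> [|x]; last exact: D_hom.
  have := EZ (a n)^-1 (EB (E_act (h n) Ee) Ee); congr E.
  by apply/funext => x; rewrite /D mulrC.
(* The directions [D n] are Cauchy on the whole unit ball. Otherwise take an ultrafilter on
   counterexamples (n, m, e): most of the e are within 1/16 of a fixed [e0], and the [D n e0] are
   within 1/16 of each other, which bounds the discrepancy by 3/16. *)
have [A FA DA] : exists2 A, F A & forall n m e x, A n -> A m -> B e ->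
    `|D n e x - D m e x| <= 1 / 4.
  apply: contrapT => nA.
  pose bad A := [set t : nat * nat * (G -> R) | [/\ A t.1.1, A t.1.2, B t.2 &
    exists x, 1 / 4 < `|D t.1.1 t.2 x - D t.1.2 t.2 x|]].
  have PJ : ProperFilter (filter_from F bad).
    apply: filter_from_proper.
      apply: filter_from_filter; first by exists setT; exact: filterT.
      move=> A1 A2 FA1 FA2; exists (A1 `&` A2); first exact: filterI.
      by move=> t [[? ?] [? ?] ? ?]; split; split.
    move=> A FA; apply: contrapT => nb; apply: nA; exists A => // n m e x An Am Be.
    rewrite leNgt; apply/negP => lt; apply: nb; exists (n, m, e); split=> //.
    by exists x.
  have [J [ultraJ FJ]] := ultraFilterLemma PJ.
  have JB : \forall t \near J, B t.2.
    by apply: FJ; exists setT; [exact: filterT|move=> t []].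
  have c16 : (0 : R) < 1 / 16 by rewrite divr_gt0.
  have [|A1 JA1 A1P] := @ultra_cauchy R _ J ultraJ G compactG B snd 1 _ E_equi JB _ c16.
    by apply: filterS JB => t [_ t1] x.
  have [[[n0 m0] e0] [/= A1e0 Be0]] := filter_ex (filterI JA1 JB).
  have [||A2 FA2 A2P] := @ultra_cauchy R _ F ultraF G compactG B
      (fun n => D n e0) 1 _ E_equi _ _ c16.
  - by apply: nearW => n; exact: D_ball.
  - by apply: nearW => n x; have [_] := D_ball n _ Be0.
  have JA2 : J (bad A2) by apply: FJ; exists A2.
  have [[[n m] e] [A1e [/= A2n A2m Be [x]]]] := filter_ex (filterI JA1 JA2).
  have De k : `|D k e x - D k e0 x| <= 1 / 16.
    rewrite (_ : D k e x - D k e0 x = D k (fun y => e y - e0 y) x); last first.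
      by rewrite /D /act -mulrBl; congr (_ / _); ring.
    apply: D_hom => [|y]; first by apply: EB; [case: Be|case: Be0].
    exact: (A1P _ _ y A1e A1e0).
  have := De n; have := De m; have := A2P n m x A2n A2m; rewrite lter_norml lter_normr.
  rewrite !ler_norml => /andP[? ?] /andP[? ?] /andP[? ?] /orP[|]; lra.
have c8 : (0 : R) < 1 / 8 by rewrite divr_gt0.
have [n [An an]] := filter_ex (filterI FA (a_small _ c8)).
have an8 : 0 < a n / 8 by rewrite divr_gt0.
(* The power of [h m] whose first-order length [k m * a m] falls short of [a n] by less than
   [a m]. *)
pose k m := Num.truncn (a n / a m).
have [|g Kg pg] := limK (fun m => h m ^+ k m)%g.
  by move=> m; apply: subgroupX => //; have [] := hP m.
have [m [[Am am] pm]] := filter_ex (filterI (filterI FA (a_small _ an8)) (near1 _ _ _ an8 pg)).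
have /truncn_itv/andP[] : 0 <= a n / a m by rewrite divr_ge0// ltW.
rewrite -/(k m) ler_pdivlMr// ltr_pdivrMr// -natr1 mulrDl mul1r => kle klt.
have k0 : 0 <= (k m)%:R * a m by rewrite mulr_ge0// ltW.
set p := (h m ^+ k m)%g in pm.
(* The errors are [a n / 8] from the second-order term, [a n / 4] from the directions and
   [a m <= a n / 8] from the rounding. *)
have close e x : B e -> `|act (h n) e x - act p e x| <= a n / 2.
  move=> Be.
  have := act_normX2 (h m) (k m) x Be; rewrite -/p -/(a m) DE.
  have := DA n m e x An Am Be; have [_ /(_ x)] := D_ball m _ Be.
  have := DE n e x.
  have : ((k m)%:R * a m) ^+ 2 <= a n / 8.
    rewrite expr2; have := a0 n => an0; nra.
  rewrite mulrA; move: kle klt k0; set t := (k m)%:R * a m => kle klt k0.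
  move: (D n e x) (D m e x) (act p e x) (act (h n) e x) (e x) => dn dm ap ah ex.
  move=> t2 dnE dm1 dnm r.
  have : `|a n * dn - t * dm| <= a n * (1 / 4) + a m * 1.
    rewrite (_ : _ - _ = a n * (dn - dm) + (a n - t) * dm); last by ring.
    apply: le_trans (ler_normD _ _) _; rewrite !normrM (gtr0_norm (a0 n)).
    rewrite lerD ?ler_pM ?(ltW (a0 n))// ger0_norm ?subr_ge0//; lra.
  move: r; rewrite !ler_norml => /andP[? ?] /andP[? ?]; apply/andP; split; lra.
have spn : s (h n * p^-1)%g <= a n / 2.
  apply: act_norm_le => e x Be; rewrite actM.
  have := close _ x (B_act p^-1%g Be); rewrite -(actM p) mulgV act1; exact.
(* Passing from [p] to its limit [g] costs [a n / 8], so h_n g^-1 has norm at most 5/8 of [a n],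
   against minimality in the coset. *)
have [_ _ /(_ g^-1%g (subgroupV sK Kg))] := hP n; rewrite -/(a n).
have := act_normM (h n * p^-1)%g (p * g^-1)%g; rewrite mulgA mulgVK.
by have := a0 n; lra.
Qed.

End TranslationKernel.

(** * Small noetherian subgroups *)

Section PeterWeyl.
Variables (R : realType) (G : topologicalGroupType).
Hypothesis hausdorffG : hausdorff_space G.
Hypothesis compactG : compact [set: G].
Local Open Scope ring_scope.
Import Order.TTheory GRing.Theory Num.Theory numFieldNormedType.Exports.
Implicit Types (e f k : G -> R) (g h : G).
Variable M : (G -> R) -> R.
Hypothesis haarM : haar_mean M.

(** The unit ball of the eigenspace is equicontinuous: from e = l^-1 conv (conv e), it lies in a
    multiple of the image under [conv] of functions bounded by 1. *)
Lemma conv_eigen_noetherian k (l : R) : continuous k ->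
  (forall z, k z^-1%g = k z) -> 0 < l ->
  noetherian (act_kernel (conv_eigen M k l)).
Proof.
move=> ck ksym l0.
have conv0 : conv M k (fun=> 0) = (fun=> 0).
  apply/funext => x; rewrite -[RHS](mean_cst haarM); congr (M _).
  by apply/funext => y; rewrite mulr0.
apply: act_kernel_noetherian => //.
- by move=> e [].
- by split=> [|x]; [exact: cfC|rewrite !conv0 mulr0].
- move=> a e f [ce eE] [cf fE]; split=> [|x]; first by apply: cfD => //; exact: cfZ.
  rewrite !(conv_lin haarM ck)//; try exact: conv_continuous.
  by rewrite eE fE; ring.
- move=> h e [ce eE]; split=> [|x].
    by apply: cf_comp => //; exact: mulgl_continuous.
  rewrite (_ : conv M k (act h e) = act h (conv M k e)).
    by rewrite (conv_mull haarM)//; exact: conv_continuous.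
  by apply/funext => y; rewrite (conv_mull haarM).
have [c c0 cb] := conv_bounded compactG haarM ck.
move=> x d d0; have d'0 : 0 < d * l / c by rewrite divr_gt0 ?mulr_gt0.
apply: filterS (conv_equi compactG haarM ck x d'0) => y Hy e [[ce eE] e1].
pose f z := c^-1 * conv M k e z.
have cke : continuous (conv M k e) by exact: conv_continuous.
have cf : continuous f by exact: cfZ.
have f1 z : `|f z| <= 1.
  rewrite /f normrM ger0_norm ?invr_ge0 ?(ltW c0)// ler_pdivrMl//.
  by have [ceb _] := cb e ce; exact: ceb.
have ef z : e z = c / l * conv M k f z.
  have := conv_lin haarM ck c^-1 cke (@cfC R G 0).
  rewrite conv0 (_ : (fun x => _ + 0) = f); last first.
    by apply/funext => t; rewrite addr0.
  by move=> ->; rewrite addr0 eE; field; rewrite !gt_eqF.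
rewrite !ef -mulrBr normrM gtr0_norm ?divr_gt0// -ler_pdivlMl ?divr_gt0//.
rewrite (_ : _^-1 * d = d * l / c); last by field; rewrite !gt_eqF.
apply: Hy; exists f => //; split=> //.
rewrite -(mean_cst haarM 1); apply: (mean_le haarM) => [||z]; [exact: cfM|exact: cfC|].
rewrite -expr2 -real_normK ?num_real//.
by rewrite exprn_ile1.
Qed.

(** By invariance of the mean, [act g k - k] is orthogonal to every eigenspace on which g acts
    trivially, so [conv] kills it. At 1 this equates the mean of k(g y) k(y) with that of k(y)^2,
    which is nonzero. *)
Lemma conv_eigen_separates k g : continuous k ->
  (forall z, k z^-1%g = k z) -> k 1%g != 0 ->
  (forall l, 0 < l -> act_kernel (conv_eigen M k l) g) ->
  exists y, k (g * y)%g != 0 /\ k y != 0.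
Proof.
move=> ck ksym k1 gE; apply: contrapT => nex.
have ckg : continuous (act g k) by apply: cf_comp => //; exact: mulgl_continuous.
have := conv_orthogonal compactG haarM ck ksym (cfB ckg ck) _ 1%g.
rewrite (_ : (fun x => act g k x - k x) = (fun x => -1 * k x + act g k x)); last first.
  by apply/funext => x; rewrite mulN1r addrC.
rewrite (conv_lin haarM)// mulN1r => T0.
have {T0} : conv M k (act g k) 1%g = conv M k k 1%g.
  apply/eqP; rewrite -subr_eq0 addrC; apply/eqP; apply: T0 => l e l0 El.
  have ce := El.1; have ege := gE l l0 e El.
  rewrite [LHS](_ : _ = M (fun x => act g k x * e x - k x * e x)); last first.
    by congr (M _); apply/funext => x; ring.
  rewrite (meanB haarM); [|exact: cfM|exact: cfM].
  rewrite (_ : (fun x => act g k x * e x) = act g (fun x => k x * e x)); last first.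
    by apply/funext => x; rewrite -{1}ege.
  by rewrite /act (mean_inv haarM g^-1%g (cfM ck ce)) subrr.
rewrite (conv_mull haarM)// mulg1 /conv invg1 invgK.
rewrite [LHS](_ : _ = 0).
  under eq_fun do rewrite mul1g.
  move/esym/(mean_sqr_eq0 compactG haarM ck)/(_ 1%g)/eqP.
  by rewrite (negbTE k1).
rewrite -[RHS](mean_cst haarM); congr (M _); apply/funext => y.
apply/eqP; rewrite mulf_eq0; apply: contra_notT nex; rewrite negb_or => /andP[? ?].
by exists y.
Qed.

(* Some convolution operator with kernel supported near 1 is nontrivial, and the
   intersection of the kernels of its eigenspaces is small. *)
Lemma noetherian_small (U : set G) : nbhs (1%g : G) U ->
  exists2 L, noetherian L & L `<=` U.
Proof.
rewrite nbhsE => -[O [oO O1] OU].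
have [V nV VO] := nbhs_mulg (open_nbhs_nbhs (conj oO O1)).
have : nbhs 1%g (V `&` [set x | V x^-1%g]) by apply: filterI => //; exact: nbhs_invg.
rewrite nbhsE => -[W [oW W1] WV].
have sep : uniform_separator (~` W) [set 1%g : G].
  apply: ((@normal_separatorP R G).1 (compact_normal hausdorffG compactG)).
  - exact: open_closedC.
  - by apply: accessible_closed_set1; exact: hausdorff_accessible.
  - by rewrite -subset0 => x [nWx x1]; apply: nWx; rewrite x1.
have [f [cf f01 f0 f1]] := (@uniform_separatorP G R _ _).1 sep.
(* The product symmetrises the Urysohn function [f] and keeps the support condition in [W]. *)
pose k z := f z * f z^-1%g.
have ck : continuous k.
  by apply: cfM => //; apply: cf_comp => //; exact: (@invg_continuous G).
have ksym z : k z^-1%g = k z by rewrite /k invgK mulrC.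
have k1 : k 1%g != 0.
  rewrite /k invg1; have -> : f 1%g = 1 by apply: f1; exists 1%g.
  by rewrite mulr1 oner_eq0.
have kW z : k z != 0 -> W z.
  move=> kz; apply: contrapT => nWz; move: kz; rewrite /k.
  have -> : f z = 0 by apply: f0; exists z.
  by rewrite mul0r eqxx.
(* Compactness applied to the family of all noetherian subgroups, directed by [noetherianI]. *)
have [||||L nL LO] := @compact_directed G compactG (@noetherian G) O _ _ _ oO.
- by exists (act_kernel (conv_eigen M k 1)); apply: conv_eigen_noetherian.
- by move=> A B nA nB; exists (A `&` B) => //; exact: noetherianI.
- by move=> A [].
- move=> g Dg; have [|y [gy y0]] := @conv_eigen_separates k g ck ksym k1.
    by move=> l l0; apply: Dg; exact: conv_eigen_noetherian.
  rewrite -[g](mulgK y); apply: VO; first by have [] := WV _ (kW _ gy).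
  by have [] := WV _ (kW _ y0).
- by exists L => //; exact: subset_trans OU.
Qed.

End PeterWeyl.

(** * Shadowing modulo noetherian subgroups *)

Section Shadowing.
Variable G : topologicalGroupType.
Hypothesis hausdorffG : hausdorff_space G.
Hypothesis compactG : compact [set: G].
Variable alpha : continuousHom G G.
Implicit Types (N L U V W : set G) (x : nat -> G) (t y z : G).
Local Open Scope group_scope.
Local Notation G0 := (@identity_component G).

(* The sequences shadowed modulo L by points of N form a shift of finite type:
   the groups alpha^n {t in N : alpha^j t in L for j < n} L of possible
   corrections at time n decrease, hence are eventually constant. *)
Lemma noetherian_shadowing N L : is_subgroup N -> closed N ->
  (forall t, N t -> N (alpha t)) -> noetherian L ->
  exists n0, forall x,
    (forall i, exists2 t, N t &
      forall j, (j <= n0)%N -> L ((iter j alpha t)^-1 * x (i + j)%N)) ->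
    exists2 t, N t & forall j, L ((iter j alpha t)^-1 * x j).
Proof.
move=> sN cN aN [sL nL cL dcc].
pose A n := N `&` [set t | forall j, (j < n)%N -> L (iter j alpha t)].
pose F n := setMg (iter n alpha @` A n) L.
have sA n : is_subgroup (A n).
  apply: subgroupI => //; split=> [j _|s t Ls Lt j jn]; first by rewrite iter_chom1; exact: sL.1.
  by rewrite iter_chomM iter_chomV; apply: sL.2; [exact: Ls|exact: Lt].
have cA n : closed (A n).
  apply: closedI => //.
  have -> : [set t | forall j, (j < n)%N -> L (iter j alpha t)] =
      \bigcap_(j in [set j | (j < n)%N]) (iter j alpha @^-1` L).
    by apply/seteqP; split=> t Lt j; exact: Lt.
  by apply: closed_bigI => j _; apply: closed_preimage => //; exact: iter_chom_continuous.
have [n|n|n|n|n0 EF] := dcc F.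
- apply: subgroup_setMg => //; split.
    by exists 1; [exact: (sA n).1|exact: iter_chom1].
  move=> _ _ [s As <-] [t At <-]; exists (s * t^-1); first exact: (sA n).2.
  by rewrite iter_chomM iter_chomV.
- apply: closed_setMg => //; apply: closed_image => //; exact: iter_chom_continuous.
- by apply: setMg_subr; exists 1; [exact: (sA n).1|exact: iter_chom1].
- move=> _ [_ [l [[t [Nt At] <-] Ll ->]]].
  exists (iter n.+1 alpha t), l; split=> //; exists (alpha t); last by rewrite iterSr.
  by split; [exact: aN|move=> j jn; rewrite -iterSr; exact: At].
exists n0.
pose loc x := forall i, exists2 t, N t &
  forall j, (j <= n0)%N -> L ((iter j alpha t)^-1 * x (i + j)%N).
have fin k x : loc x ->
    exists2 t, N t & forall j, (j <= k)%N -> L ((iter j alpha t)^-1 * x j).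
  elim: k x => [|k IH] x lx.
    have [t Nt Lt] := lx 0%N; exists t => // j; rewrite leqn0 => /eqP ->.
    exact: (Lt 0%N).
  have [kn0|n0k] := ltnP k n0.
    have [t Nt Lt] := lx 0%N; exists t => // j jk.
    by apply: (Lt j); exact: leq_trans kn0.
  have [y Ny Ly] := IH x lx.
  have [|z Nz Lz] := IH (fun i => x i.+1).
    by move=> i; have [t Nt Lt] := lx i.+1; exists t.
  (* [y] follows x up to time k, and [z] follows the shifted sequence up to time k. Their mismatch
     [r] is invisible modulo [L] before time k, and stationarity of [F] replaces it by some [s] in
     [N] invisible up to time k, so that [y * s] is also right at time k + 1. *)
  pose r := (alpha y)^-1 * z.
  have rE j : iter j alpha r = (iter j.+1 alpha y)^-1 * iter j alpha z.
    by rewrite iter_chomM iter_chomV -iterSr.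
  have Ar : A k r.
    split=> [|j jk].
      by apply: subgroupM => //; apply: subgroupV => //; exact: aN.
    have -> : iter j alpha r =
        ((iter j.+1 alpha y)^-1 * x j.+1) * ((iter j alpha z)^-1 * x j.+1)^-1.
      by rewrite rE invgM invgK mulgA mulgK.
    by apply: sL.2; [exact: Ly|apply: Lz; exact: ltnW].
  have Fr : F k (iter k alpha r) by apply: setMg_subl; [exact: sL.1|exists r].
  have Fr' : F n0 (iter k alpha r).
    apply: chain_sub Fr => // n _ [_ [l [[t [Nt At] <-] Ll ->]]].
    exists (iter n.+1 alpha t), l; split=> //; exists (alpha t); last by rewrite iterSr.
    by split; [exact: aN|move=> j jn; rewrite -iterSr; exact: At].
  have [_ [l [[s [Ns Ls] <-] Ll rkE]]] := EF k.+1 (leqW n0k) _ Fr'.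
  exists (y * s) => [|j]; first exact: subgroupM.
  rewrite iter_chomM invgM -mulgA leq_eqVlt => /predU1P[->|jk]; last first.
    by apply: subgroupM => //; [apply: subgroupV => //; exact: Ls|exact: Ly].
  have -> : (iter k.+1 alpha y)^-1 = iter k alpha r * (iter k alpha z)^-1.
    by rewrite rE mulgK.
  by rewrite rkE -!mulgA mulKg; apply: subgroupM => //; exact: Lz.
move=> x lx; apply: contrapT => nt.
(* Compactness passes from finite blocks to the whole sequence: the closed decreasing sets [S k] are
   nonempty by [fin]. *)
pose S k := N `&` [set t | forall j, (j <= k)%N -> L ((iter j alpha t)^-1 * x j)].
have dS m n : (m <= n)%N -> S n `<=` S m.
  move=> mn t [Nt St]; split=> // j jm; apply: St; exact: leq_trans mn.
have [|_ _ [m _ <-] [n _ <-]|_ [k _ <-]|t St|_ [k _ <-] S0] :=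
    @compact_directed G compactG [set S k | k in setT] set0 _ _ _ open0.
- by exists (S 0%N); exists 0%N.
- exists (S (maxn m n)); first by exists (maxn m n).
  by move=> t St; split; apply: dS St; rewrite ?leq_maxl ?leq_maxr.
- apply: closedI => //.
  have -> : [set t | forall j, (j <= k)%N -> L ((iter j alpha t)^-1 * x j)] =
      \bigcap_(j in [set j | (j <= k)%N]) ((fun t => (iter j alpha t)^-1 * x j) @^-1` L).
    by apply/seteqP; split=> t Lt j; exact: Lt.
  apply: closed_bigI => j _; apply: closed_preimage => //.
  apply: mulg_fun_continuous => t; last exact: cvg_cst.
  by apply: cvg_invg; exact: iter_chom_continuous.
- apply: nt; exists t; first by have [] := St (S 0%N) (ex_intro2 _ _ 0%N I erefl).
  by move=> j; have [_] := St (S j) (ex_intro2 _ _ j I erefl); apply.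
- by have [t Nt Lt] := fin k x lx; exact: (S0 t).
Qed.

Lemma noetherian_iter L n : noetherian L ->
  exists2 M, noetherian M & forall t j, (j <= n)%N -> M t -> L (iter j alpha t).
Proof.
move=> nL; elim: n => [|n [M nM ML]].
  by exists L => // t j; rewrite leqn0 => /eqP ->.
exists (L `&` alpha @^-1` M).
  by apply: noetherianI => //; exact: noetherian_preimage.
move=> t [|j] jn [Lt Mt] //; rewrite iterSr; exact: ML.
Qed.

Lemma nbhs_iter U n : nbhs 1 U ->
  nbhs 1 [set t | forall j, (j <= n)%N -> U (iter j alpha t)].
Proof.
move=> nU; elim: n => [|n nn].
  by apply: filterS nU => t Ut j; rewrite leqn0 => /eqP ->.
have : nbhs 1 [set t | U (iter n.+1 alpha t)].
  by apply: (@iter_chom_continuous _ alpha n.+1 1); rewrite iter_chom1.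
move/(filterI nn); apply: filterS => t [Un Ut] j.
by rewrite leq_eqVlt => /predU1P[->//|/Un].
Qed.

Lemma identity_restriction_iter n (t : identity_component_type G) :
  val (iter n (identity_restriction alpha) t) = iter n alpha (val t).
Proof. by elim: n => //= n <-. Qed.

Lemma nbhs_identity_component (U : set (identity_component_type G)) :
  nbhs 1 U -> exists2 V : set G, nbhs 1 V & val @^-1` V `<=` U.
Proof.
move=> [_ [[V oV <-] V1 VU]]; exists V => //; apply: open_nbhs_nbhs.
by split=> //; move: V1; rewrite /preimage /= set_valE val1.
Qed.

Lemma val_nbhs_identity_component V : nbhs (1 : G) V ->
  nbhs (1 : identity_component_type G) (val @^-1` V).
Proof.
by move=> nV; apply: (@identity_component_val_continuous G 1); rewrite val1.
Qed.

(** * Transfer of shadowing between G and its identity component *)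

Hypothesis noetherian_small : forall U, nbhs (1 : G) U ->
  exists2 L, noetherian L & L `<=` U.

Lemma identity_restriction_shadowing : has_shadowing alpha ->
  has_shadowing (identity_restriction alpha).
Proof.
move=> sh U /nbhs_identity_component [U1 nU1 U1U].
have [U2 nU2 U2U1] := nbhs_mulg nU1.
have [L nL LU2] := noetherian_small nU2.
have [n0 sft] := noetherian_shadowing (@identity_component_subgroup G)
  (@identity_component_closed G) (@identity_component_stable G alpha) nL.
have [M nM ML] := noetherian_iter n0 nL.
pose W := setMg G0 M.
have [sM nlM cM _] := nM.
have sW : is_subgroup W by apply: subgroup_setMg => //; exact: identity_component_subgroup.
have nW : nbhs 1 W by exact: noetherian_nbhs.
have [V nV shV] := sh _ (filterI nU2 nW).
exists (val @^-1` V); first exact: val_nbhs_identity_component.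
move=> x px; have [|y yx] := shV (fun i => val (x i)).
  by move=> i; exact: px.
have [i|t Gt Lt] := sft (fun i => iter i alpha y).
  (* Since [x i] lies in G0, the orbit of y stays in [W]. Writing alpha^i y = t m, the choice of [M]
     keeps the first [n0] iterates of m in [L], so t follows the block modulo [L]. *)
  have : W (iter i alpha y).
    have -> : iter i alpha y =
        val (x i) * ((iter i alpha y)^-1 * val (x i))^-1.
      by rewrite invgM invgK mulVKg.
    apply: sW.2; last by have [] := yx i.
    by apply: setMg_subl; [exact: sM.1|exact: set_mem (valP (x i))].
  move=> [t [m [Gt Mm yE]]]; exists t => // j jn0.
  by rewrite addnC iterD yE iter_chomM mulKg; exact: ML.
exists (exist _ t (mem_set Gt)) => i; apply: U1U.
rewrite /preimage /= identity_restriction_iter /=.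
rewrite -(mulVKg (iter i alpha y) (val (x i))) mulgA.
by apply: U2U1; [apply: LU2; exact: Lt|have [] := yx i].
Qed.

Lemma shadowing_identity_restriction :
  has_shadowing (identity_restriction alpha) -> has_shadowing alpha.
Proof.
move=> sh U nU.
have [U1 nU1 U1U] := nbhs_mulg nU.
have [V nV shV] := sh _ (val_nbhs_identity_component nU1).
have [V1 nV1 V1V] := nbhs_identity_component nV.
have [V2 nV2 V2V1] := nbhs_mulg nV1.
have [V3 nV3 V3V2] := nbhs_mulg nV2.
(* The conditions on a remainder u in [L]: u itself enters the final shadowing estimate, while alpha
   u and u^-1 enter the pseudo-orbit estimate for [n]. *)
have nP : nbhs 1 (U1 `&` (alpha @^-1` V3 `&` [set u | V2 u^-1])).
  apply: filterI => //; apply: filterI; last exact: nbhs_invg.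
  have /(_ 1 V3) : continuous alpha by exact: cts_fun.
  by rewrite chom1; exact.
have [L nL LP] := noetherian_small nP.
pose W := setMg G0 L.
have [sL nlL cL _] := nL.
have sG0 := @identity_component_subgroup G.
have sW : is_subgroup W by exact: subgroup_setMg.
have nW : nbhs 1 W by exact: noetherian_nbhs.
have noW : noetherian W.
  apply: noetherianS nL _ _ _ _ => //.
  - by apply: setMg_subr; exact: sG0.1.
  - by apply: normal_setMg => //; exact: identity_component_normal.
  - exact: nbhs_closed.
have [//||//|n0 sft] := @noetherian_shadowing setT W _ _ _ noW.
  exact: closedT.
(* The second condition lets each block of x be followed modulo [W] by its own first point. *)
exists (V3 `&` [set t | forall j, (j <= n0)%N -> W (iter j alpha t)]).
  by apply: filterI => //; exact: nbhs_iter.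
move=> x px.
have [i|y _ Wy] := sft x.
  exists (x i) => // j; elim: j i => [|j IH] i jn.
    by rewrite addn0 /= mulVg; exact: sW.1.
  rewrite iterSr -(mulVKg (iter j alpha (x i.+1)) (x (i + j.+1)%N)) mulgA.
  apply: subgroupM => //; last by rewrite -addSnnS; apply: IH; exact: ltnW.
  rewrite -iter_chomV -iter_chomM; have [_] := px i; apply.
  exact: ltnW.
have /boolp.choice[n Ln] : forall i, exists g : identity_component_type G,
    L ((val g)^-1 * ((iter i alpha y)^-1 * x i)).
  move=> i; have [g [l [Gg Ll yE]]] := Wy i.
  by exists (exist _ g (mem_set Gg)); rewrite yE mulKg.
have [i|m mn] := shV n.
  apply: V1V; rewrite /preimage /=.
  (* The remainder in [L] of the factorisation of [x i] as alpha^i y times [n i] times [u i]. The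
     orbit of y cancels in the error of [n]. *)
  set u := fun i => (val (n i))^-1 * ((iter i alpha y)^-1 * x i).
  have -> : (alpha (val (n i)))^-1 * val (n i.+1) =
      (alpha (u i) * ((alpha (x i))^-1 * x i.+1)) * (u i.+1)^-1.
    rewrite /u !chomM !chomV !invgM !invgK !mulgA !mulgK /=.
    by rewrite mulgVK.
  apply: V2V1; last by have [_ []] := LP _ (Ln i.+1).
  by apply: V3V2; [have [_ []] := LP _ (Ln i)|have [] := px i].
exists (y * val m) => i.
rewrite iter_chomM invgM -mulgA -(mulVKg (val (n i)) (_^-1 * x i)) mulgA.
apply: U1U; last by have [] := LP _ (Ln i).
by have := mn i; rewrite /preimage /= identity_restriction_iter.
Qed.

End Shadowing.

Theorem theoremA (G : topologicalGroupType) (hausdorffG : hausdorff_space G)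
    (compactG : compact [set: G]) (alpha : continuousHom G G) :
  has_shadowing alpha <-> has_shadowing (identity_restriction alpha).
Proof.
have [M haarM] := haar_mean_exists Rdefinitions.R compactG.
have small U := @noetherian_small Rdefinitions.R G hausdorffG compactG M haarM U.
by split; [exact: identity_restriction_shadowing|exact: shadowing_identity_restriction].
Qed.
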